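(* Consider the adaptive experiment described in the context, with $Y_t\in[0,1]$ for all $t$ and propensity scores truncated so that $\pi_t(a\mid X_t,\Omega_{t-1})\in\left[\frac{1}{k_t},1-\frac{1}{k_t}\right]$, $k_t\ge2$. Fix $\alpha\in(0,1)$ and $\sigma_0^2>0$. Define $$\xi_t = \frac{h_t}{k_t + 1},\quad \hat{\xi}_{t-1} = \left(\frac{1}{t-1} \sum_{i=1}^{t-1} \xi_i \right) \wedge \frac{1}{k_t + 1},\quad \psi_E(\lambda) = - \log(1- \lambda) - \lambda,$$ $$\bar{\xi}_t = \left(\frac{1}{t} \sum_{i = 1}^{t} \xi_i\right) \wedge \frac{1}{k_t + 1},\quad \hat{\sigma}^2_t = \frac{\sigma^2_0 + \sum_{i = 1}^t (\xi_i - \bar{\xi}_i)^2}{t+1},\quad \lambda_t = \sqrt{\frac{2 \log (2/ \alpha)}{\hat{\sigma}^2_{t-1}\, t \log(1 + t)}} \wedge \frac12 .$$ Then the intervals $$C_T^{PrPI-EB} = \frac{\sum_{t=1}^T \lambda_t \xi_t}{\sum_{t=1}^T \lambda_t/(k_t + 1)} \pm \frac{\log(2/\alpha) + \sum_{t=1}^T \left(\xi_t - \hat{\xi}_{t-1} \right)^2 \psi_{E}(\lambda_t)}{\sum_{t=1}^T \lambda_t / (k_t + 1)},\qquad T\ge1,$$ form a $(1-\alpha)$-confidence sequence for $\theta_0$, i.e. $\mathbb{P}(\forall T\ge1:\ \theta_0\in C_T^{PrPI-EB})\ge 1-\alpha$.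
   Context: Data-generating process: subjects $t=1,2,\dots$ arrive sequentially. The tuples $(X_t, Y_t(0), Y_t(1))$ are i.i.d. over $t$. Let $\Omega_{t-1}=\{(X_s,A_s,Y_s): s\le t-1\}$ be the history. Given $X_t$ and $\Omega_{t-1}$, the treatment $A_t\in\{0,1\}$ is drawn with $\mathbb{P}(A_t=1\mid X_t,\Omega_{t-1})=\pi_t(1\mid X_t,\Omega_{t-1})$ (and $\pi_t(0\mid\cdot)=1-\pi_t(1\mid\cdot)$), independently of the current potential outcomes; the observed outcome is $Y_t = \mathbb{1}[A_t=0]Y_t(0)+\mathbb{1}[A_t=1]Y_t(1)$. $\theta_0=\mathbb{E}[Y(1)-Y(0)]$. $\hat f_t(a,x)$ is an estimator of $\mathbb{E}[Y(a)\mid X=x]$ constructed from $\Omega_t$, and $$h_t=\frac{\mathbb{1}[A_t=1](Y_t-\hat f_{t-1}(1,X_t))}{\pi_t(1\mid X_t,\Omega_{t-1})}-\frac{\mathbb{1}[A_t=0](Y_t-\hat f_{t-1}(0,X_t))}{\pi_t(0\mid X_t,\Omega_{t-1})}+\hat f_{t-1}(1,X_t)-\hat f_{t-1}(0,X_t).$$ $k_t$ is a user-chosen truncation parameter.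
   Formalization: The estimates f̂_{t-1}(a,X_t) are assumed to lie in [0,1] (the claim fails for unbounded f̂); Y_t(0), Y_t(1) lie in [0,1]; k_t is deterministic; A_t is drawn, given X_t and Ω_{t-1}, independently of all subjects' tuples, past and future included. *)

(* Defs.v *)
From HB Require Import structures.
From mathcomp Require Import all_boot all_order all_algebra.
From mathcomp Require Import all_classical all_reals all_analysis.
Set Implicit Arguments. Unset Strict Implicit. Unset Printing Implicit Defensive.
Import Order.TTheory GRing.Theory Num.Theory.
Import numFieldNormedType.Exports.
Local Open Scope classical_set_scope.
Local Open Scope ring_scope.

(* Time is indexed by t = 1, 2, ...; index 0 is never used. *)

Section AdaptiveExperiment.
Context {R : realType} {dT : measure_display} {T : measurableType dT}
        {dX : measure_display} {Xs : measurableType dX}.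

Definition Yobs (A : nat -> T -> bool) (Y0 Y1 : nat -> T -> R) (t : nat) (w : T) : R :=
  if A t w then Y1 t w else Y0 t w.

Definition Ztuple (X : nat -> T -> Xs) (Y0 Y1 : nat -> T -> R) (t : nat) (w : T)
  : Xs * R * R := (X t w, Y0 t w, Y1 t w).

Definition hist (X : nat -> T -> Xs) (A : nat -> T -> bool) (Y0 Y1 : nat -> T -> R)
  (n : nat) (w : T) : seq (Xs * bool * R) :=
  [seq (X s w, A s w, Yobs A Y0 Y1 s w) | s <- iota 1 n].

(* generators of sigma(X_t, Omega_{t-1}) *)
Definition gen_XtHist (X : nat -> T -> Xs) (A : nat -> T -> bool) (Y0 Y1 : nat -> T -> R)
  (t : nat) : set (set T) :=
  [set E | (exists B : set Xs, measurable B /\ E = X t @^-1` B) \/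
           (exists s, (1 <= s < t)%N /\
             ((exists B : set Xs, measurable B /\ E = X s @^-1` B) \/
              (exists b : bool, E = [set w | A s w = b]) \/
              (exists B : set R, measurable B /\ E = Yobs A Y0 Y1 s @^-1` B)))].

(* generators of sigma(Omega_{t-1}, (X_s, Y_s(0), Y_s(1))_{s >= 1}) *)
Definition gen_HistTuples (X : nat -> T -> Xs) (A : nat -> T -> bool) (Y0 Y1 : nat -> T -> R)
  (t : nat) : set (set T) :=
  [set E | (exists s, (0 < s)%N /\ exists B : set (Xs * R * R),
                 measurable B /\ E = Ztuple X Y0 Y1 s @^-1` B) \/
           (exists s, (1 <= s < t)%N /\ exists b : bool, E = [set w | A s w = b])].

Definition measurable_wrt (F : set (set T)) (f : T -> R) : Prop :=
  forall B : set R, measurable B -> F (f @^-1` B).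

Definition iid_tuples (P : probability T R) (Z : nat -> T -> Xs * R * R) : Prop :=
  (forall t, measurable_fun setT (Z t)) /\
  (forall (S : seq nat) (B : nat -> set (Xs * R * R)),
      uniq S -> all (fun s => 0 < s)%N S -> (forall s, measurable (B s)) ->
      P (\big[setI/setT]_(s <- S) (Z s @^-1` B s))
      = (\prod_(s <- S) fine (P (Z s @^-1` B s)))%:E) /\
  (forall t (B : set (Xs * R * R)), (0 < t)%N -> measurable B ->
      P (Z t @^-1` B) = P (Z 1%N @^-1` B)).

End AdaptiveExperiment.

Section Estimator.
Context {R : realType}.

Definition psiE (l : R) : R := - ln (1 - l) - l.

(* running quantities, for a fixed realisation: xi : nat -> R (xi_1, xi_2, ...),
   k : nat -> R truncation parameters *)
Definition avg (xi : nat -> R) (n : nat) : R := (n%:R)^-1 * \sum_(1 <= i < n.+1) xi i.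

Definition xihat (k xi : nat -> R) (t : nat) : R := Num.min (avg xi t.-1) (k t + 1)^-1.

Definition xibar (k xi : nat -> R) (t : nat) : R := Num.min (avg xi t) (k t + 1)^-1.

Definition sigma2hat (sigma02 : R) (k xi : nat -> R) (t : nat) : R :=
  (sigma02 + \sum_(1 <= i < t.+1) (xi i - xibar k xi i) ^+ 2) / (t%:R + 1).

Definition lambda (alpha sigma02 : R) (k xi : nat -> R) (t : nat) : R :=
  Num.min (Num.sqrt (2 * ln (2 / alpha) /
             (sigma2hat sigma02 k xi t.-1 * t%:R * ln (1 + t%:R)))) (2^-1).

Definition CS_denom (alpha sigma02 : R) (k xi : nat -> R) (TT : nat) : R :=
  \sum_(1 <= t < TT.+1) lambda alpha sigma02 k xi t / (k t + 1).

Definition CS_center (alpha sigma02 : R) (k xi : nat -> R) (TT : nat) : R :=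
  (\sum_(1 <= t < TT.+1) lambda alpha sigma02 k xi t * xi t)
  / CS_denom alpha sigma02 k xi TT.

Definition CS_radius (alpha sigma02 : R) (k xi : nat -> R) (TT : nat) : R :=
  (ln (2 / alpha) + \sum_(1 <= t < TT.+1)
       (xi t - xihat k xi t) ^+ 2 * psiE (lambda alpha sigma02 k xi t))
  / CS_denom alpha sigma02 k xi TT.

End Estimator.

Section AIPW.
Context {R : realType} {dT : measure_display} {T : measurableType dT}
        {dX : measure_display} {Xs : measurableType dX}.

(* h_t(w), with pi t x H = pi_t(1 | x, H) and fhat n a x H = \hat f_n(a, x)
   built from the history H = Omega_n *)
Definition hAIPW (X : nat -> T -> Xs) (A : nat -> T -> bool) (Y0 Y1 : nat -> T -> R)
  (pi : nat -> Xs -> seq (Xs * bool * R) -> R)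
  (fhat : nat -> bool -> Xs -> seq (Xs * bool * R) -> R) (t : nat) (w : T) : R :=
  let H := hist X A Y0 Y1 t.-1 w in
  let x := X t w in
  let p1 := pi t x H in
  let f1 := fhat t.-1 true x H in
  let f0 := fhat t.-1 false x H in
  let y := Yobs A Y0 Y1 t w in
  (if A t w then (y - f1) / p1 else 0) - (if A t w then 0 else (y - f0) / (1 - p1))
  + f1 - f0.

End AIPW.

(* Main.v *)
(* Write b_t = 1 / (k_t + 1), so that |xi_t| <= 1 - b_t and xi_t has conditional
   mean b_t theta_0. For s = 1 and s = -1 the process
     prod_t exp (s lambda_t (xi_t - b_t theta_0) - (xi_t - xihat_t)^2 psiE (lambda_t))
   is a nonnegative supermartingale, and the confidence sequence fails exactly
   when one of the two exceeds 2 / alpha; Ville's inequality for their average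
   gives the coverage.

   For s = 1 the supermartingale property is Fan's inequality
   exp (l y - y^2 psiE l) <= 1 + l y, valid for y >= -1. For s = -1 it needs
   y = xihat_t - xi_t >= -1, which fails when xihat_t < - b_t. In that case put
   u = xi_t + b_t in [-1, 1], whose conditional mean is nonnegative because
   theta_0 >= -1, and e = - b_t - xihat_t in [0, 1]. Then
     exp (- l u - (u + e)^2 psiE l) <= 1 - (l + 2 e (1 - l) psiE l) u
   for l <= 1/2, which suffices since the slope is at least l. *)
Require Import Defs.
From HB Require Import structures.
From mathcomp Require Import all_boot all_order all_algebra.
From mathcomp Require Import all_classical all_reals all_analysis.
From mathcomp Require Import measurable_realfun zify ring lra.
Set Implicit Arguments. Unset Strict Implicit. Unset Printing Implicit Defensive.
Import Order.TTheory GRing.Theory Num.Theory.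
Import numFieldNormedType.Exports.
Local Open Scope classical_set_scope.
Local Open Scope ring_scope.

(** * Bounds on the logarithm and on psiE *)

(** The two signs differ because [xihat] is capped by b_t from above only; from below the running
    mean is merely at least -1, which is where e <= 1 comes from. The bound l <= 1/2 is the
    truncation of [lambda]. For u < 0 the polynomial estimate behind the shifted inequality has
    little room at l = 1/2, hence the expansions of [psiE] to order six. Both one-step bounds are
    affine in xi_t with coefficients fixed by the past, since only the range and the conditional
    mean of xi_t are available. That mean has to be derived: the i.i.d. hypothesis concerns tuples
    alone, while the history also contains treatments. Randomisation is conditional on all tuples,
    so treatments can be revealed one at a time without destroying the independence of a later
    tuple. Conditional expectations appear only as integrals against bounded functions measurable
    for the past. *)

Lemma is_derive_ge0_le (R : realType) (f df : R -> R) (a b : R) :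
  a <= b ->
  (forall x, a <= x <= b -> is_derive x 1 f (df x)) ->
  (forall x, a <= x <= b -> 0 <= df x) -> f a <= f b.
Proof.
move=> ab fdf df0.
have sub x : x \in `]a, b[ -> a <= x <= b.
  by rewrite in_itv/= => /andP[ax xb]; rewrite !ltW.
apply: (@ger0_derive1_ndecr _ f a b) => //.
- by move=> x /sub /fdf; case.
- by move=> x /sub xab; rewrite derive1E; have [_ ->] := fdf _ xab; exact: df0.
- apply: derivable_within_continuous => x; rewrite in_itv/= => /fdf.
  by case.
Qed.

Lemma is_derive_ln1D (R : realType) (c y : R) : 0 < 1 + c * y ->
  is_derive y 1 (fun z => ln (1 + c * z)) (c / (1 + c * y)).
Proof.
move=> y0.
have H1 : is_derive y 1 (fun z : R => 1 + c * z) c.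
  by apply: is_derive_eq; rewrite /GRing.scale/=; ring.
have H2 := is_derive1_ln y0.
have := @is_derive1_comp _ (@ln R) (fun z => 1 + c * z) y _ _ H2 H1.
by move=> H; apply: is_derive_eq; rewrite mulrC.
Qed.

Definition ln_taylor {R : realType} (y : R) : R :=
  y - y ^+ 2 / 2 + y ^+ 3 / 3 - y ^+ 4 / 4 + y ^+ 5 / 5 - y ^+ 6 / 6.

(** The degree is even, so the remainder is nondecreasing on both sides of 0: one polynomial bounds
    ln (1 + y) from below for y >= 0 and from above for y <= 0. *)
Lemma is_derive_ln_taylor (R : realType) (y : R) : 0 < 1 + y ->
  is_derive y 1 (fun z => ln (1 + 1 * z) - ln_taylor z) (y ^+ 6 / (1 + y)).
Proof.
move=> y0.
have H1 : is_derive y 1 (fun z => ln (1 + 1 * z)) (1 / (1 + 1 * y)).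
  by apply: is_derive_ln1D; rewrite mul1r.
rewrite /ln_taylor.
apply: is_derive_eq.
rewrite /GRing.scale/= ?mul1r.
field.
by rewrite gt_eqF.
Qed.

Lemma ln_taylor_le (R : realType) (y : R) : 0 <= y -> ln_taylor y <= ln (1 + y).
Proof.
move=> y0.
have := @is_derive_ge0_le R (fun z => ln (1 + 1 * z) - ln_taylor z)
  (fun z => z ^+ 6 / (1 + z)) 0 y y0.
rewrite /= /ln_taylor !expr0n/= !(mul0r, subr0, addr0, mul1r) ln1 => H.
rewrite -subr_ge0; apply: H => x /andP[x0 _].
- by apply: is_derive_ln_taylor; lra.
- by rewrite divr_ge0 ?exprn_ge0//; lra.
Qed.

Lemma ln_le_taylor (R : realType) (y : R) : -1 < y -> y <= 0 ->
  ln (1 + y) <= ln_taylor y.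
Proof.
move=> y1 y0.
have := @is_derive_ge0_le R (fun z => ln (1 + 1 * z) - ln_taylor z)
  (fun z => z ^+ 6 / (1 + z)) y 0 y0.
rewrite /= /ln_taylor !expr0n/= !(mul0r, subr0, addr0, mul1r) ln1 => H.
rewrite -subr_le0; apply: H => x /andP[xy x0].
- by apply: is_derive_ln_taylor; lra.
- by rewrite divr_ge0 ?exprn_even_ge0//; lra.
Qed.

Lemma psiE_ge (R : realType) (l : R) : 0 <= l < 1 ->
  l ^+ 2 / 2 + l ^+ 3 / 3 + l ^+ 4 / 4 + l ^+ 5 / 5 + l ^+ 6 / 6 <= psiE l.
Proof.
move=> /andP[l0 l1]; have := @ln_le_taylor _ (- l).
rewrite /ln_taylor /psiE => H.
have {}H := H ltac:(lra) ltac:(lra).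
lra.
Qed.

Lemma is_derive_psiE_scale (R : realType) (c l : R) : c * l < 1 ->
  is_derive l 1 (fun z => psiE (c * z)) (c * (c * l) / (1 - c * l)).
Proof.
move=> l1.
have H1 : is_derive l 1 (fun z : R => ln (1 + (- c) * z)) (- c / (1 + (- c) * l)).
  by apply: is_derive_ln1D; rewrite mulNr; lra.
have -> : (fun z => psiE (c * z)) = (fun z => - ln (1 + (- c) * z) - c * z).
  by apply/funext => z; rewrite /psiE mulNr.
apply: is_derive_eq; rewrite /GRing.scale/=.
field; lra.
Qed.

Lemma psiE0 (R : realType) : psiE (0 : R) = 0.
Proof. by rewrite /psiE !subr0 ln1 oppr0. Qed.

(** The terms of order at least five in [psiE l] sum to at most l^5 / (5 (1 - l)), and l <= 1/2
    turns this into 2/5 l^5. *)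
Lemma psiE_le (R : realType) (l : R) : 0 <= l <= 1 / 2 ->
  psiE l <= l ^+ 2 / 2 + l ^+ 3 / 3 + l ^+ 4 / 4 + 2 / 5 * l ^+ 5.
Proof.
move=> /andP[l0 l1].
have := @is_derive_ge0_le R (fun z => z ^+ 2 / 2 + z ^+ 3 / 3 + z ^+ 4 / 4 +
  2 / 5 * z ^+ 5 - psiE (1 * z))
  (fun z => z ^+ 4 * (1 - 2 * z) / (1 - z)) 0 l l0.
rewrite /= !expr0n/= !(mul0r, mulr0, subr0, addr0, mul1r) psiE0 subr0.
rewrite subr_ge0; apply => x /andP[x0 xl].
- have x1 : 1 * x < 1 by lra.
  have H1 := is_derive_psiE_scale x1.
  apply: is_derive_eq; rewrite /GRing.scale/=.
  field; lra.
- by rewrite divr_ge0 ?mulr_ge0 ?exprn_ge0//; lra.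
Qed.

(** The power series of [psiE] starts at order two and x^j <= x^2 for j >= 2; the proof compares
    derivatives in l instead of summing. *)
Lemma psiE_scale_le (R : realType) (x l : R) : 0 <= l < 1 -> 0 <= x <= 1 ->
  psiE (x * l) <= x ^+ 2 * psiE l.
Proof.
move=> /andP[l0 l1] /andP[x0 x1].
have := @is_derive_ge0_le R (fun z => x ^+ 2 * psiE (1 * z) - psiE (x * z))
  (fun z => x ^+ 2 * (z ^+ 2 * (1 - x)) / ((1 - z) * (1 - x * z))) 0 l l0.
rewrite /= !(mulr0, mul1r) psiE0 mulr0 subr0 subr_ge0; apply => z /andP[z0 zl].
- have z1 : 1 * z < 1 by lra.
  have xz1 : x * z < 1 by nra.
  have H1 := is_derive_psiE_scale z1.
  have H2 := is_derive_psiE_scale xz1.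
  apply: is_derive_eq; rewrite /GRing.scale/=.
  field; lra.
- have xz1 : x * z < 1 by nra.
  apply: divr_ge0; apply: mulr_ge0; rewrite ?exprn_ge0 ?mulr_ge0 ?exprn_ge0//; lra.
Qed.

Lemma ln1D_ge (R : realType) (y : R) : 0 <= y -> y - y ^+ 2 / 2 <= ln (1 + y).
Proof.
move=> y0.
have := @is_derive_ge0_le R (fun z => ln (1 + 1 * z) - (z - z ^+ 2 / 2))
  (fun z => z ^+ 2 / (1 + z)) 0 y y0.
rewrite /= !expr0n/= !(mul0r, subr0, addr0, mul1r) ln1 => H.
rewrite -subr_ge0; apply: H => x /andP[x0 _].
- have H1 : is_derive x 1 (fun z => ln (1 + 1 * z)) (1 / (1 + 1 * x)).
    by apply: is_derive_ln1D; lra.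
  apply: is_derive_eq; rewrite /GRing.scale/=; field; lra.
- by rewrite divr_ge0 ?exprn_ge0//; lra.
Qed.

Lemma expRN_le (R : realType) (y : R) : 0 <= y -> expR (- y) <= 1 - y + y ^+ 2 / 2.
Proof.
move=> y0.
have := @is_derive_ge0_le R (fun z => (1 - z + z ^+ 2 / 2) - expR (- z))
  (fun z => expR (- z) - (1 - z)) 0 y y0.
rewrite /= !expr0n/= !(mul0r, subr0, oppr0, addr0, mul1r) expR0 subrr => H.
rewrite -subr_ge0; apply: H => x /andP[x0 _].
- by apply: is_derive_eq; rewrite /GRing.scale/=; field.
- by rewrite subr_ge0 expR_ge1Dx.
Qed.

Lemma psiE_ge2 (R : realType) (l : R) : 0 <= l < 1 -> l ^+ 2 / 2 <= psiE l.
Proof.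
move=> l01; have := psiE_ge l01; move: l01 => /andP[l0 l1].
have := exprn_ge0 3 l0; have := exprn_ge0 4 l0; have := exprn_ge0 5 l0.
by have := exprn_ge0 6 l0; lra.
Qed.

Lemma psiE_ge0 (R : realType) (l : R) : 0 <= l < 1 -> 0 <= psiE l.
Proof.
by move=> l01; apply: le_trans (psiE_ge2 l01); rewrite divr_ge0 ?sqr_ge0.
Qed.

Lemma expR_le_of_ln (R : realType) (a b : R) : 0 < b -> a <= ln b -> expR a <= b.
Proof. by move=> b0 ab; rewrite -[leRHS]lnK ?posrE// ler_expR. Qed.

(** For y >= 0, ln (1 + l y) >= l y - l^2 y^2 / 2 and [psiE l] >= l^2 / 2. For y < 0, ln (1 + l y) =
    l y - psiE (- y l), and [psiE_scale_le] extracts y^2; this is where y >= -1 enters. *)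
Lemma fan_inequality (R : realType) (l y : R) : 0 <= l < 1 -> -1 <= y ->
  expR (l * y - y ^+ 2 * psiE l) <= 1 + l * y.
Proof.
move=> l01 y1; have /andP[l0 l1] := l01.
apply: expR_le_of_ln; first by nra.
have [y0|y0] := leP 0 y.
- have ly0 : 0 <= l * y by rewrite mulr_ge0.
  have := ln1D_ge ly0; have := psiE_ge2 l01; have := sqr_ge0 y.
  by rewrite exprMn; nra.
- have := @psiE_scale_le _ (- y) l l01; rewrite /psiE -/(psiE l) sqrrN.
  have -> : 1 - - y * l = 1 + l * y by ring.
  by move=> /(_ ltac:(lra)); lra.
Qed.

(** * Fan's inequality with a shifted centre *)

Lemma psiE_le_fifth (R : realType) (l : R) : 0 <= l <= 1 / 2 -> psiE l <= 1 / 5.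
Proof.
move=> l02; have := psiE_le l02; move: l02 => /andP[l0 l1].
have h n : l ^+ n <= (1 / 2) ^+ n by rewrite lerXn2r ?nnegrE//; lra.
have := h 2; have := h 3; have := h 4; have := h 5; rewrite !expr_div_n !expr1n.
lra.
Qed.

(* The slope l + 2 e (1 - l) psi is, to first order in e, the largest one
   compatible with the point u = 1, where Fan's inequality is an equality. *)
Lemma shifted_fan_pos (R : realType) (l e u : R) :
  0 <= l <= 1 / 2 -> 0 <= e <= 1 -> 0 <= u <= 1 ->
  expR (- l * u - (u + e) ^+ 2 * psiE l) <= 1 - (l + 2 * e * (1 - l) * psiE l) * u.
Proof.
move=> l02 /andP[e0 e1] /andP[u0 u1].
have p5 := psiE_le_fifth l02; move: l02 => /andP[l0 l2].
have l01 : 0 <= l < 1 by lra.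
have p0 := psiE_ge0 l01.
have lu : 0 <= 1 - l * u by nra.
set p := psiE l in p5 p0 *.
(* As (u + e)^2 = u^2 + e (2 u + e), Fan's inequality at - u takes the u^2 part and X is the rest of
   the exponent. *)
have [X hX] : exists X, X = e * p * (2 * u + e) by eexists.
have X0 : 0 <= X by rewrite hX !mulr_ge0//; lra.
have -> : - l * u - (u + e) ^+ 2 * p = (l * - u - (- u) ^+ 2 * p) + - X.
  by rewrite hX; ring.
rewrite expRD.
apply: (@le_trans _ _ ((1 + l * - u) * (1 - X + X ^+ 2 / 2))).
  apply: ler_pM; rewrite ?expR_ge0//; last exact: expRN_le.
  by apply: fan_inequality => //; lra.
(* X = 2 e u p + e^2 p, so e^2 p absorbs the quadratic term of exp (- X) and leaves the factor 1 - 2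
   e u p. The 9 below is (2 u + e)^2 at u = e = 1. *)
have X2 : X ^+ 2 / 2 <= e ^+ 2 * p.
  have h : p * (2 * u + e) ^+ 2 <= 2.
    have h1 : (2 * u + e) ^+ 2 <= 9 by nra.
    have h0 := sqr_ge0 (2 * u + e).
    by nra.
  have : 0 <= e ^+ 2 * p by rewrite mulr_ge0 ?sqr_ge0.
  rewrite hX !exprMn; nra.
have : (1 - l * u) * (X ^+ 2 / 2) <= (1 - l * u) * (e ^+ 2 * p).
  by rewrite ler_wpM2l.
(* The gain from 1 - l u >= 1 - l, which turns 2 e u p (1 - l u) into the slope's 2 e u p (1 -
   l). *)
have : 0 <= e * p * l * u * (1 - u) by rewrite !mulr_ge0//; lra.
rewrite hX; lra.
Qed.

(* Expanded in n = 1 - x, the difference of the two sides is at least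
   (1 + x) (c0 + n (c1 + n c2 + n^2 c3)). *)
Lemma poly_bound (R : realType) (l x : R) : 0 <= l <= 1 / 2 -> 0 <= x <= 1 ->
  l * (1 / 2 + 14 / 25 * l) * (1 + x) ^+ 2 <=
  ((1 + x) / 3 + l * (1 - x ^+ 2) / 4 + l ^+ 2 / 5 + l ^+ 3 / 6) *
  ((1 + l * x) ^+ 2 - x ^+ 2 / 10).
Proof.
move=> /andP[l0 l2] /andP[x0 x1].
(* Since 2 = (1 + x) + n, l^2 / 5 + l^3 / 6 equals ((1 + x) + n) (l^2 / 10 + l^3 / 12). The n part
   is dropped, and a is what multiplies 1 + x. *)
have [a ha] : exists a, a = 1 / 3 + l ^+ 2 / 10 + l ^+ 3 / 12 by eexists.
have l2_le : l ^+ 2 <= l / 2 by nra.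
have l2_ge : 0 <= l ^+ 2 by rewrite sqr_ge0.
have l3_ge : 0 <= l ^+ 3 by rewrite exprn_ge0.
have l3_le : l ^+ 3 <= l ^+ 2 / 2 by rewrite exprS; nra.
have a_ge : 1 / 3 <= a by lra.
have a_le : a <= 3 / 8 by lra.
have [n hn] : exists n, n = 1 - x by eexists.
have n0 : 0 <= n by lra.
have n1 : n <= 1 by lra.
pose c0 := a * ((1 + l) ^+ 2 - 1 / 10) - 2 * l * (1 / 2 + 14 / 25 * l).
pose c1 := l / 4 * ((1 + l) ^+ 2 - 1 / 10) - a * (2 * l * (1 + l) - 1 / 5)
  + l * (1 / 2 + 14 / 25 * l).
pose c2 := a * (l ^+ 2 - 1 / 10) - l / 4 * (2 * l * (1 + l) - 1 / 5).
pose c3 := l / 4 * (l ^+ 2 - 1 / 10).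
have c0_ge : 0 <= c0.
  rewrite /c0 ha.
  (* At l = 1/2 only about 0.013 is left in [c0], so l^3 and l^4 are replaced by their tangents
     there. *)
  have h3 : 3 / 4 * l - 1 / 4 <= l ^+ 3.
    have : 0 <= (l - 1 / 2) ^+ 2 * (l + 1) by rewrite mulr_ge0 ?sqr_ge0//; lra.
    lra.
  have h4 : 1 / 2 * l - 3 / 16 <= l ^+ 4.
    have : 0 <= (l - 1 / 2) ^+ 2 * ((l + 1 / 2) ^+ 2 + 1 / 2).
      by rewrite mulr_ge0 ?addr_ge0 ?sqr_ge0//; lra.
    lra.
  have h5 : 0 <= l ^+ 5 by rewrite exprn_ge0.
  lra.
have hc : 0 <= c1 + n * c2 + n ^+ 2 * c3.
  have c1_ge : 1 / 20 + l ^+ 2 / 2 <= c1 by rewrite /c1; nra.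
  have c2_ge : - (3 / 80) - l ^+ 2 / 2 <= c2 by rewrite /c2; nra.
  have c3_ge : - (1 / 80) <= c3 by rewrite /c3; nra.
  have := ler_wpM2l n0 c2_ge.
  have := ler_wpM2l (sqr_ge0 n) c3_ge.
  nra.
have hF : 0 <= c0 + n * (c1 + n * c2 + n ^+ 2 * c3) by rewrite addr_ge0// mulr_ge0.
have Q0 : 0 <= (1 + l * x) ^+ 2 - x ^+ 2 / 10.
  have : 0 <= l * x by rewrite mulr_ge0.
  nra.
apply: (@le_trans _ _ ((1 + x) * (a + l * n / 4) * ((1 + l * x) ^+ 2 - x ^+ 2 / 10))).
  rewrite -subr_ge0.
  have -> : (1 + x) * (a + l * n / 4) * ((1 + l * x) ^+ 2 - x ^+ 2 / 10) -
     l * (1 / 2 + 14 / 25 * l) * (1 + x) ^+ 2 =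
     (1 + x) * (c0 + n * (c1 + n * c2 + n ^+ 2 * c3)).
    by rewrite /c0 /c1 /c2 /c3 hn; field.
  by rewrite mulr_ge0//; lra.
apply: ler_wpM2r => //; rewrite hn ha.
have : 0 <= n * (l ^+ 2 / 10 + l ^+ 3 / 12) by rewrite mulr_ge0//; lra.
by rewrite hn; lra.
Qed.

(** At l = 1/2 the factor 1/3 + l/4 + 2/5 l^2 equals 67/120, just below 14/25. *)
Lemma psiE_le_cubic (R : realType) (l : R) : 0 <= l <= 1 / 2 ->
  psiE l <= l ^+ 2 * (1 / 2 + 14 / 25 * l).
Proof.
move=> l02; apply: le_trans (psiE_le l02) _; move: l02 => /andP[l0 l2].
have -> : l ^+ 2 / 2 + l ^+ 3 / 3 + l ^+ 4 / 4 + 2 / 5 * l ^+ 5 =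
  l ^+ 2 * (1 / 2 + l * (1 / 3 + l / 4 + 2 / 5 * l ^+ 2)) by field.
rewrite ler_wpM2l ?sqr_ge0// lerD2l [leRHS]mulrC ler_wpM2l//.
nra.
Qed.

(* After ln (1 + z) >= z - z^2 / 2, the inequality of shifted_fan_neg is quadratic
   in e; this is the nonpositivity of its discriminant. *)
Lemma discriminant_bound (R : realType) (l x : R) :
  0 <= l <= 1 / 2 -> 0 <= x <= 1 ->
  psiE l * (l * (1 + x)) ^+ 2 <=
  (psiE l - l ^+ 2 / 2 + l ^+ 3 * x / 3 - l ^+ 4 * x ^+ 2 / 4) *
  ((1 + l * x) ^+ 2 - 2 * x ^+ 2 * (1 - l) ^+ 2 * psiE l).
Proof.
move=> l02 x01.
have l01 : 0 <= l < 1 by lra.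
have pb := poly_bound l02 x01; have pge := psiE_ge l01.
have ple := psiE_le_cubic l02.
move: l02 x01 => /andP[l0 l2] /andP[x0 x1].
have [p hp] : exists p, p = psiE l by eexists.
rewrite -hp in pge ple *.
have l3_ge : 0 <= l ^+ 3 by rewrite exprn_ge0.
(* l^3 P and Q bound the two factors on the right from below, by [psiE_ge] and by (1 - l)^2 p <=
   1/20. With [ple] on the left, what remains is l^3 times [pb]. *)
set P := _ + l ^+ 3 / 6 in pb.
set Q := _ - x ^+ 2 / 10 in pb.
have P0 : 0 <= P.
  rewrite /P; have : 0 <= l * (1 - x ^+ 2) by rewrite mulr_ge0//; nra.
  have := sqr_ge0 l; lra.
have Q0 : 0 <= Q.
  have : 0 <= l * x by apply: mulr_ge0.
  rewrite /Q; nra.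
have hK : Q <= (1 + l * x) ^+ 2 - 2 * x ^+ 2 * (1 - l) ^+ 2 * p.
  rewrite /Q lerD2l lerN2.
  have h1 : (1 - l) ^+ 2 * p <= 1 / 20.
    have h2 : (l * (1 - l)) ^+ 2 <= 1 / 16.
      have h0 : 0 <= l * (1 - l) by rewrite mulr_ge0//; lra.
      have h3 : l * (1 - l) <= 1 / 4 by nra.
      nra.
    have := ler_wpM2l (sqr_ge0 (1 - l)) ple.
    have : (l * (1 - l)) ^+ 2 * (1 / 2 + 14 / 25 * l) <= 1 / 16 * (39 / 50).
      by apply: ler_pM => //; rewrite ?sqr_ge0//; lra.
    lra.
  have := ler_wpM2l (sqr_ge0 x) h1; lra.
have hd : l ^+ 3 * P <= p - l ^+ 2 / 2 + l ^+ 3 * x / 3 - l ^+ 4 * x ^+ 2 / 4.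
  rewrite /P; lra.
have hPQ := ler_pM (mulr_ge0 l3_ge P0) Q0 hd hK.
apply: le_trans hPQ.
have := ler_wpM2l l3_ge pb.
have := ler_wpM2r (sqr_ge0 (l * (1 + x))) ple.
lra.
Qed.

Lemma shifted_fan_neg (R : realType) (l e x : R) :
  0 <= l <= 1 / 2 -> 0 <= e -> 0 <= x <= 1 ->
  expR (l * x - (x - e) ^+ 2 * psiE l) <= 1 + (l + 2 * e * (1 - l) * psiE l) * x.
Proof.
move=> l02 e0 x01.
have disc := discriminant_bound l02 x01.
have p5 := psiE_le_fifth l02.
move: l02 x01 => /andP[l0 l2] /andP[x0 x1].
have l01 : 0 <= l < 1 by lra.
have p0 := psiE_ge0 l01.
have [p hp] : exists p, p = psiE l by eexists.
rewrite -hp in disc p0 p5 *.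
have lx0 : 0 <= l * x by rewrite mulr_ge0.
have lx1 : l * x <= 1 / 2 by nra.
have D0 : 0 < 1 + l * x by lra.
(* Chosen so that the right side factors as (1 + l x) (1 + z); its logarithm then splits into a part
   free of e and ln (1 + z). *)
have [z hz] : exists z, z = 2 * e * x * (1 - l) * p / (1 + l * x) by eexists.
have z0 : 0 <= z by rewrite hz divr_ge0 ?mulr_ge0//; lra.
have -> : 1 + (l + 2 * e * (1 - l) * p) * x = (1 + l * x) * (1 + z).
  by rewrite hz; field; rewrite gt_eqF.
apply: expR_le_of_ln; first by rewrite mulr_gt0//; lra.
rewrite lnM ?posrE//; last by lra.
have h1 : l * x - x ^+ 2 * (l ^+ 2 / 2 - l ^+ 3 * x / 3 + l ^+ 4 * x ^+ 2 / 4)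
    <= ln (1 + l * x).
  apply: le_trans (ln_taylor_le lx0); rewrite /ln_taylor.
  have : 0 <= (l * x) ^+ 5 * (1 / 5 - l * x / 6).
    by rewrite mulr_ge0 ?exprn_ge0//; lra.
  lra.
have h2 := ln1D_ge z0.
suff : 0 <= x ^+ 2 * (p - l ^+ 2 / 2 + l ^+ 3 * x / 3 - l ^+ 4 * x ^+ 2 / 4)
   - 2 * e * x * p + e ^+ 2 * p + z - z ^+ 2 / 2 by lra.
move: disc; set d := (X in _ <= X * _ -> _); set K := (X in _ <= _ * X -> _) => disc.
have K0 : 0 < K.
  rewrite /K.
  have : (1 - l) ^+ 2 * p <= 1 / 5 by have := sqr_ge0 (1 - l); nra.
  have := sqr_ge0 x; nra.
have -> : x ^+ 2 * d - 2 * e * x * p + e ^+ 2 * p + z - z ^+ 2 / 2 =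
  (x ^+ 2 * d * (1 + l * x) ^+ 2 - 2 * e * x * p * (l * (1 + x)) * (1 + l * x) +
   e ^+ 2 * p * K) / (1 + l * x) ^+ 2.
  by rewrite /K hz; field; rewrite gt_eqF.
(* Completing the square in e: K times the numerator is x^2 (1 + l x)^2 times the gap in [disc],
   plus p (l (1 + x) x (1 + l x) - e K)^2. *)
rewrite divr_ge0 ?sqr_ge0// -(pmulr_lge0 _ K0).
have := ler_wpM2l (sqr_ge0 (x * (1 + l * x))) disc.
have : 0 <= p * (l * (1 + x) * x * (1 + l * x) - e * K) ^+ 2.
  by rewrite mulr_ge0 ?sqr_ge0.
lra.
Qed.

Lemma shifted_fan (R : realType) (l e u : R) :
  0 <= l <= 1 / 2 -> 0 <= e <= 1 -> -1 <= u <= 1 ->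
  expR (- l * u - (u + e) ^+ 2 * psiE l) <= 1 - (l + 2 * e * (1 - l) * psiE l) * u.
Proof.
move=> l02 e01 /andP[u0 u1]; have [u_ge0|u_lt0] := leP 0 u.
  by apply: shifted_fan_pos => //; rewrite u_ge0.
have := @shifted_fan_neg _ l e (- u) l02; case/andP: e01 => -> _ /(_ isT).
have -> : l * - u - (- u - e) ^+ 2 * psiE l = - l * u - (u + e) ^+ 2 * psiE l by ring.
by rewrite mulrN; apply; lra.
Qed.

(** * One-step bounds, affine in the observation *)

Lemma expRN_mul1D_le1 (R : realType) (a : R) : expR (- a) * (1 + a) <= 1.
Proof.
by rewrite expRN mulrC ler_pdivrMr ?expR_gt0// mul1r expR_ge1Dx.
Qed.

(** The cap c <= b gives xi - c >= -1. The right side is affine in xi, so its conditional mean is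
    its value at m, which [upper_step_mean] bounds by 1. *)
Lemma upper_step (R : realType) (l b m xi c : R) :
  0 <= l <= 1 / 2 -> - (1 - b) <= xi -> c <= b ->
  expR (l * (xi - m) - (xi - c) ^+ 2 * psiE l) <=
  expR (l * (c - m)) * (1 + l * (xi - c)).
Proof.
move=> /andP[l0 l2] xib cb.
have -> : l * (xi - m) - (xi - c) ^+ 2 * psiE l =
  l * (c - m) + (l * (xi - c) - (xi - c) ^+ 2 * psiE l) by ring.
by rewrite expRD ler_wpM2l ?expR_ge0// fan_inequality//; lra.
Qed.

Lemma upper_step_mean (R : realType) (l m c : R) :
  expR (l * (c - m)) * (1 + l * (m - c)) <= 1.
Proof. by rewrite -(opprB m c) mulrN expRN_mul1D_le1. Qed.

(* When the estimate c is below - b, a deviation xi - c may exceed 1, outside the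
   range of Fan's inequality; the increment is then recentred at - b, which is
   still at most the conditional mean, and the larger slope absorbs the shift. *)
Definition lower_shift {R : realType} (b c : R) : R := Num.max c (- b).

Definition lower_slope {R : realType} (l b c : R) : R :=
  l + 2 * (lower_shift b c - c) * (1 - l) * psiE l.

Lemma lower_step (R : realType) (l b m xi c : R) :
  0 <= l <= 1 / 2 -> 0 <= b -> - (1 - b) <= xi <= 1 - b -> -1 <= c ->
  expR (- (l * (xi - m)) - (xi - c) ^+ 2 * psiE l) <=
  expR (- (l * (lower_shift b c - m))) *
  (1 - lower_slope l b c * (xi - lower_shift b c)).
Proof.
move=> l02 b0 /andP[xi0 xi1] c1.
have -> : - (l * (xi - m)) - (xi - c) ^+ 2 * psiE l =
  - (l * (lower_shift b c - m)) + (- l * (xi - lower_shift b c) -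
  ((xi - lower_shift b c) + (lower_shift b c - c)) ^+ 2 * psiE l) by ring.
rewrite expRD ler_wpM2l ?expR_ge0// /lower_slope.
have [cb|cb] := leP c (- b).
  by rewrite /lower_shift (max_r cb); apply: shifted_fan => //; lra.
rewrite /lower_shift (max_l (ltW cb)) subrr addr0 mulr0 !mul0r addr0.
have := @fan_inequality _ l (c - xi); rewrite -(opprB xi c) sqrrN mulrN -mulNr.
by rewrite -mulNr; apply; lra.
Qed.

Lemma lower_step_mean (R : realType) (l b m c : R) :
  0 <= l <= 1 / 2 -> - b <= m ->
  expR (- (l * (lower_shift b c - m))) *
  (1 - lower_slope l b c * (m - lower_shift b c)) <= 1.
Proof.
move=> l02 bm; rewrite /lower_slope.
apply: le_trans (expRN_mul1D_le1 (l * (lower_shift b c - m))).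
rewrite ler_wpM2l ?expR_ge0// -(opprB (lower_shift b c) m) mulrN opprK lerD2l.
have [cb|cb] := leP c (- b); last first.
  by rewrite /lower_shift (max_l (ltW cb)) subrr mulr0 !mul0r addr0.
rewrite /lower_shift (max_r cb) mulrDl gerDl.
have : 0 <= 2 * (- b - c) * (1 - l) * psiE l.
  have l01 : 0 <= l < 1 by lra.
  by rewrite !mulr_ge0 ?psiE_ge0//; lra.
by move=> h; rewrite mulr_ge0_le0//; lra.
Qed.

(** * Bounded measurable functions and Ville's inequality *)

(** Every quantity at a fixed time is uniformly bounded, the truncation parameters being
    deterministic, so integrability never has to be tracked separately. *)
Definition bounded_mfun {d : measure_display} {T : measurableType d} {R : realType}
  (f : T -> R) : Prop := measurable_fun setT f /\ exists C : R, forall w, `|f w| <= C.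

Section BoundedFunctions.
Context {d : measure_display} {T : measurableType d} {R : realType}.
Variable P : probability T R.
Implicit Types f g : T -> R.

Lemma bounded_mfun_cst (c : R) : bounded_mfun (fun _ : T => c).
Proof. by split; [exact: measurable_cst|exists `|c|]. Qed.

Lemma bounded_mfunD f g : bounded_mfun f -> bounded_mfun g ->
  bounded_mfun (fun w => f w + g w).
Proof.
move=> [mf [C fC]] [mg [K gK]]; split; first exact: measurable_funD.
by exists (C + K) => w; apply: le_trans (ler_normD _ _) _; exact: lerD.
Qed.

Lemma bounded_mfunM f g : bounded_mfun f -> bounded_mfun g ->
  bounded_mfun (fun w => f w * g w).
Proof.
move=> [mf [C fC]] [mg [K gK]]; split; first exact: measurable_funM.
by exists (C * K) => w; rewrite normrM; exact: ler_pM.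
Qed.

Lemma bounded_mfunN f : bounded_mfun f -> bounded_mfun (fun w => - f w).
Proof.
move=> [mf [C fC]]; split; first exact: measurableT_comp.
by exists C => w; rewrite normrN.
Qed.

Lemma bounded_mfunB f g : bounded_mfun f -> bounded_mfun g ->
  bounded_mfun (fun w => f w - g w).
Proof. by move=> bf bg; apply: bounded_mfunD => //; exact: bounded_mfunN. Qed.

Lemma bounded_mfun_indic (A : set T) : measurable A ->
  bounded_mfun (\1_A : T -> R).
Proof.
move=> mA; split; first exact: measurable_indic.
by exists 1 => w; rewrite indicE; case: (_ \in _); rewrite ?normr1 ?normr0.
Qed.

Lemma bounded_mfun_sum (I : Type) (r : seq I) (F : I -> T -> R) :
  (forall i, bounded_mfun (F i)) ->
  bounded_mfun (fun w => \sum_(i <- r) F i w).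
Proof.
move=> bF; elim: r => [|i r ih].
  under eq_fun do rewrite big_nil.
  exact: bounded_mfun_cst.
under eq_fun do rewrite big_cons.
exact: bounded_mfunD.
Qed.

Lemma bounded_mfun_sum_nat (m n : nat) (F : nat -> T -> R) :
  (forall i, (m <= i < n)%N -> bounded_mfun (F i)) ->
  bounded_mfun (fun w => \sum_(m <= i < n) F i w).
Proof.
move=> bF.
have -> : (fun w => \sum_(m <= i < n) F i w) =
    (fun w => \sum_(m <= i < n) (if (m <= i < n)%N then F i w else 0)).
  by apply/funext => w; apply: eq_big_nat => i h; rewrite h.
apply: bounded_mfun_sum => i.
by case: (boolP (m <= i < n)%N) => [/bF|_] //; exact: bounded_mfun_cst.
Qed.

Lemma bounded_mfun_min f g : bounded_mfun f -> bounded_mfun g ->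
  bounded_mfun (fun w => Num.min (f w) (g w)).
Proof.
move=> [mf [C fC]] [mg [K gK]]; split; first exact: measurable_minr.
exists (C + K) => w; have C0 := le_trans (normr_ge0 _) (fC w).
have K0 := le_trans (normr_ge0 _) (gK w).
by rewrite minEle; case: ifP => _; [apply: le_trans (fC w) _|apply: le_trans (gK w) _]; lra.
Qed.

Lemma bounded_mfun_max f g : bounded_mfun f -> bounded_mfun g ->
  bounded_mfun (fun w => Num.max (f w) (g w)).
Proof.
move=> [mf [C fC]] [mg [K gK]]; split; first exact: measurable_maxr.
exists (C + K) => w; have C0 := le_trans (normr_ge0 _) (fC w).
have K0 := le_trans (normr_ge0 _) (gK w).
by rewrite maxEle; case: ifP => _; [apply: le_trans (gK w) _|apply: le_trans (fC w) _]; lra.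
Qed.

Lemma bounded_mfun_expR f : bounded_mfun f -> bounded_mfun (fun w => expR (f w)).
Proof.
move=> [mf [C fC]]; split; first exact: measurableT_comp.
exists (expR C) => w; rewrite ger0_norm ?expR_ge0// ler_expR.
exact: le_trans (ler_norm _) (fC w).
Qed.

Lemma bounded_mfun_integrable f : bounded_mfun f -> P.-integrable setT (EFin \o f).
Proof.
move=> [mf [C fC]]; apply: measurable_bounded_integrable => //.
  by rewrite [X in (X < _)%E]probability_setT ltry.
exists C; split; rewrite ?num_real// => x Cx w _.
exact: le_trans (fC w) (ltW Cx).
Qed.

Lemma mean_cst (c : R) : \int[P]_w c = c.
Proof. by rewrite Rintegral_cst// [X in fine X]probability_setT mulr1. Qed.

Lemma meanD f g : bounded_mfun f -> bounded_mfun g ->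
  \int[P]_w (f w + g w) = \int[P]_w f w + \int[P]_w g w.
Proof. by move=> bf bg; apply: RintegralD => //; exact: bounded_mfun_integrable. Qed.

Lemma meanB f g : bounded_mfun f -> bounded_mfun g ->
  \int[P]_w (f w - g w) = \int[P]_w f w - \int[P]_w g w.
Proof. by move=> bf bg; apply: RintegralB => //; exact: bounded_mfun_integrable. Qed.

Lemma meanZ (c : R) f : bounded_mfun f -> \int[P]_w (c * f w) = c * \int[P]_w f w.
Proof. by move=> bf; apply: RintegralZl => //; exact: bounded_mfun_integrable. Qed.

Lemma le_mean f g : bounded_mfun f -> bounded_mfun g -> (forall w, f w <= g w) ->
  \int[P]_w f w <= \int[P]_w g w.
Proof.
by move=> bf bg fg; apply: le_Rintegral => //; exact: bounded_mfun_integrable.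
Qed.

Lemma mean_sum (I : Type) (r : seq I) (F : I -> T -> R) :
  (forall i, bounded_mfun (F i)) ->
  \int[P]_w (\sum_(i <- r) F i w) = \sum_(i <- r) \int[P]_w F i w.
Proof.
move=> bF; elim: r => [|i r ih].
  by rewrite big_nil; under eq_Rintegral do rewrite big_nil; rewrite mean_cst.
rewrite big_cons; under eq_Rintegral do rewrite big_cons.
by rewrite meanD ?ih//; exact: bounded_mfun_sum.
Qed.

Lemma mean_indic (A : set T) : measurable A -> \int[P]_w \1_A w = fine (P A).
Proof. by move=> mA; rewrite /Rintegral integral_indic// setIT. Qed.

Lemma norm_mean_le f (C : R) : bounded_mfun f -> (forall w, `|f w| <= C) ->
  `|\int[P]_w f w| <= C.
Proof.
move=> bf fC; rewrite ler_norml; apply/andP; split.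
  rewrite -[- C]mean_cst; apply: le_mean => //; first exact: bounded_mfun_cst.
  by move=> w; have := fC w; rewrite ler_norml => /andP[].
rewrite -[C]mean_cst; apply: le_mean => //; first exact: bounded_mfun_cst.
by move=> w; exact: le_trans (ler_norm _) (fC w).
Qed.

End BoundedFunctions.

(** The sum counts the integers from 1 to N that are at most y, so it is the integer part of y.
    Scaled by 1/N, it approximates a [0,1]-valued function uniformly by indicators of superlevel
    sets. *)
Lemma sum_thresholds_approx (R : realType) (N : nat) (y : R) : 0 <= y <= N%:R ->
  `|y - \sum_(1 <= i < N.+1) (i%:R <= y)%R%:R| <= 1.
Proof.
move=> /andP[y0 yN].
have H n : [/\ \sum_(1 <= i < n.+1) (i%:R <= y)%R%:R <= n%:R :> R,
   \sum_(1 <= i < n.+1) (i%:R <= y)%R%:R <= y &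
   y < \sum_(1 <= i < n.+1) (i%:R <= y)%R%:R + 1 \/
   \sum_(1 <= i < n.+1) (i%:R <= y)%R%:R = n%:R :> R].
  elim: n => [|n [h1 h2 h3]]; first by rewrite big_geq//; split => //; right.
  rewrite big_nat_recr//=; have [ny|yn] := leP n.+1%:R y.
    have hn : \sum_(1 <= i < n.+1) (i%:R <= y)%R%:R = n%:R :> R.
      case: h3 => // h3; move: ny; rewrite -natr1 => ny.
      by exfalso; lra.
    by rewrite hn natr1; split => //; right.
  rewrite addr0; split => //.
    by apply: le_trans h1 _; rewrite ler_nat.
  case: h3 => h3; left => //.
  by rewrite h3 natr1.
have [h1 h2 h3] := H N.
rewrite ler_norml; apply/andP; split; first by lra.
by case: h3 => h3; lra.
Qed.

(** * Integration against a sub-sigma-algebra, and Ville's inequality *)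

Section SubSigmaAlgebra.
Context {d : measure_display} {T : measurableType d} {R : realType}.
Implicit Types (G : set (set T)) (f g : T -> R).

(** Retyping the domain makes the general lemmas on measurable functions apply to the sigma-algebra
    generated by [G]. *)
Definition gmeasurable G f : Prop :=
  measurable_fun (setT : set (g_sigma_algebraType G)) (f : g_sigma_algebraType G -> R).

Lemma gmeasurableP G f : measurable_wrt <<s G >> f <-> gmeasurable G f.
Proof.
split=> mf; first by move=> _ B mB; rewrite setTI; exact: mf.
by move=> B mB; rewrite -[X in <<s G >> X]setTI; exact: mf.
Qed.

Lemma sigma_measurable G : G `<=` measurable -> <<s G >> `<=` measurable.
Proof. by move=> Gm; apply: smallest_sub => //; exact: sigma_algebra_measurable. Qed.

Lemma sigma_sub G1 G2 : G1 `<=` <<s G2 >> -> <<s G1 >> `<=` <<s G2 >>.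
Proof. by move=> G12; apply: smallest_sub => //. Qed.

Lemma gmeasurable_sub G1 G2 f : <<s G1 >> `<=` <<s G2 >> ->
  gmeasurable G1 f -> gmeasurable G2 f.
Proof. by move=> G12 /gmeasurableP mf; apply/gmeasurableP => B mB; apply: G12; exact: mf. Qed.

Lemma gmeasurable_measurable G f : G `<=` measurable ->
  gmeasurable G f -> measurable_fun setT f.
Proof.
move=> Gm /gmeasurableP mf _ B mB; rewrite setTI.
by apply: (sigma_measurable Gm); exact: mf.
Qed.

Variable P : probability T R.

(* Stands in for E[D | G] = 0. *)
Lemma mean_mul_eq0 G (D W : T -> R) : G `<=` measurable ->
  bounded_mfun D -> gmeasurable G W -> (exists C : R, forall w, `|W w| <= C) ->
  (forall E, <<s G >> E -> \int[P]_w (\1_E w * D w) = 0) ->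
  \int[P]_w (W w * D w) = 0.
Proof.
move=> Gm bD.
have H01 : forall W : T -> R, gmeasurable G W -> (forall w, 0 <= W w <= 1) ->
    (forall E, <<s G >> E -> \int[P]_w (\1_E w * D w) = 0) ->
    \int[P]_w (W w * D w) = 0.
  move=> {}W gW W01 D0; have [C CD] := bD.2.
  have bW : bounded_mfun W.
    split; first exact: gmeasurable_measurable gW.
    by exists 1 => w; rewrite ger0_norm; case/andP: (W01 w).
  have C0 : 0 <= C := le_trans (normr_ge0 _) (CD point).
  (* Staircase approximation: W is within 1 / (N + 1) of an average of indicators of superlevel
     sets, each integrating to 0 against D. *)
  have small (N : nat) : `|\int[P]_w (W w * D w)| <= C / N.+1%:R.
    pose E i := [set w | i%:R <= N.+1%:R * W w].
    have GE i : <<s G >> (E i).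
      have mNW : gmeasurable G (fun w => N.+1%:R * W w).
        by apply: measurable_funM => //; exact: measurable_cst.
      move/gmeasurableP : mNW => /(_ `[i%:R, +oo[%classic).
      have -> : E i = (fun w => N.+1%:R * W w) @^-1` `[i%:R, +oo[%classic.
        by apply/seteqP; split => w; rewrite /E/= in_itv/= andbT.
      by apply; exact: measurable_itv.
    have bE i : bounded_mfun (fun w => \1_(E i) w * D w).
      apply: bounded_mfunM => //; apply: bounded_mfun_indic.
      exact: (sigma_measurable Gm).
    pose S w := \sum_(1 <= i < N.+2) \1_(E i) w * D w.
    have bS : bounded_mfun S by exact: bounded_mfun_sum.
    have S0 : \int[P]_w S w = 0.
      by rewrite /S mean_sum// big1// => i _; exact: D0.
    have bWD := bounded_mfunM bW bD.
    have bNS : bounded_mfun (fun w => N.+1%:R^-1 * S w).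
      by apply: bounded_mfunM => //; exact: bounded_mfun_cst.
    have -> : \int[P]_w (W w * D w) =
        \int[P]_w (W w * D w - N.+1%:R^-1 * S w).
      by rewrite meanB// meanZ// S0 mulr0 subr0.
    apply: norm_mean_le; first exact: bounded_mfunB.
    move=> w.
    have -> : W w * D w - N.+1%:R^-1 * S w =
      D w * (N.+1%:R^-1 * (N.+1%:R * W w - \sum_(1 <= i < N.+2) (i%:R <= N.+1%:R * W w)%R%:R)).
      have -> : S w = (\sum_(1 <= i < N.+2) (i%:R <= N.+1%:R * W w)%R%:R) * D w.
        rewrite /S mulr_suml; apply: eq_bigr => i _; rewrite indicE; congr ((nat_of_bool _)%:R * _).
        by rewrite /E; apply/idP/idP => [/set_mem|h]//; exact: mem_set.
      by field.
    rewrite normrM ler_pM// normrM ger0_norm ?invr_ge0//.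
    rewrite -[leRHS]mulr1 ler_wpM2l ?invr_ge0//.
    apply: sum_thresholds_approx; have /andP[W0 W1] := W01 w.
    by rewrite mulr_ge0//= -[leRHS]mulr1 ler_wpM2l.
  apply/normr0_eq0/eqP; rewrite eq_le normr_ge0 andbT.
  apply/ler_addgt0Pl => e e0; rewrite addr0.
  have [n Cn] : exists n : nat, C / e < n%:R.
    exists (Num.truncn (C / e)).+1.
    by rewrite truncnS_gt// ?num_real// divr_ge0// ltW.
  apply: le_trans (small n) _.
  rewrite ler_pdivrMr// mulrC -ler_pdivrMr//.
  by apply: le_trans (ltW Cn) _; rewrite ler_nat.
move=> gW [C WC] D0.
(* Affine rescaling of W into [0, 1]; the constant it adds disappears because D has mean 0, the case
   E = [setT]. The 1 keeps K positive when C = 0. *)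
pose K := C + 1.
have K0 : 0 < K.
  by rewrite /K; have := le_trans (normr_ge0 _) (WC point); lra.
pose W' w := (2 * K)^-1 * (W w + K).
have gW' : gmeasurable G W'.
  by apply: measurable_funM; [exact: measurable_cst|
    apply: measurable_funD => //; exact: measurable_cst].
have W'01 w : 0 <= W' w <= 1.
  have := WC w; rewrite ler_norml => /andP[h1 h2].
  have K2 : 0 < 2 * K by rewrite mulr_gt0.
  have WK : 0 <= W w + K <= 2 * K by rewrite /K; lra.
  by case/andP: WK => WK0 WK1; rewrite /W' mulrC divr_ge0 ?(ltW K2)//= ler_pdivrMr ?mul1r.
have bW' : bounded_mfun W'.
  split; first exact: gmeasurable_measurable gW'.
  by exists 1 => v; have /andP[v0 v1] := W'01 v; rewrite ger0_norm.
have bWD := bounded_mfunM bW' bD.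
have -> : \int[P]_w (W w * D w) = \int[P]_w (2 * K * (W' w * D w) - K * D w).
  apply: eq_Rintegral => w _; rewrite /W'; field.
  by rewrite gt_eqF.
have b1 : bounded_mfun (fun w => 2 * K * (W' w * D w)).
  by apply: bounded_mfunM => //; exact: bounded_mfun_cst.
have b2 : bounded_mfun (fun w => K * D w).
  by apply: bounded_mfunM => //; exact: bounded_mfun_cst.
rewrite (meanB P b1 b2) !meanZ//.
rewrite H01// mulr0 sub0r.
have -> : \int[P]_w D w = 0.
  rewrite -[RHS](D0 setT); last exact: (@measurableT _ (g_sigma_algebraType G)).
  by apply: eq_Rintegral => w _; rewrite indicT mul1r.
by rewrite mulr0 oppr0.
Qed.

End SubSigmaAlgebra.

Lemma gmeasurable_le {d : measure_display} {T : measurableType d} {R : realType}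
  (G : set (set T)) (f : T -> R) (c : R) :
  gmeasurable G f -> <<s G >> [set w | f w <= c].
Proof.
move=> /gmeasurableP /(_ `]-oo, c]%classic).
have -> : [set w | f w <= c] = f @^-1` `]-oo, c]%classic.
  by apply/seteqP; split => w; rewrite /= in_itv.
by apply; exact: measurable_itv.
Qed.

(** In place of optional stopping, the mean of c (1 - 1_F) + 1_F M_N is shown by induction to be at
    most 1, where F says that c has not been exceeded up to time N. This is the stopped process with
    its value at crossing lowered to c. Continuity from above then lets N grow. *)
Lemma ville_inequality {d : measure_display} {T : measurableType d} {R : realType}
  (P : probability T R) (G : nat -> set (set T)) (M : nat -> T -> R) (c : R) :
  (forall n, G n `<=` measurable) ->
  (forall n, <<s G n >> `<=` <<s G n.+1 >>) ->
  (forall n, gmeasurable (G n) (M n)) ->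
  (forall n, exists C : R, forall w, `|M n w| <= C) ->
  (forall n w, 0 <= M n w) -> (forall w, M 0 w = 1) ->
  (forall n E, <<s G n >> E ->
     \int[P]_w (\1_E w * M n.+1 w) <= \int[P]_w (\1_E w * M n w)) ->
  0 < c ->
  measurable [set w | forall n, M n w <= c] /\
  ((1 - c^-1)%:E <= P [set w | forall n, (M n w <= c)%R])%E.
Proof.
move=> Gm Gmono gM bM M0 M1 superM c0.
pose F N := \bigcap_(n < N.+1) [set w | M n w <= c].
have FE N w : F N w <-> forall n, (n <= N)%N -> M n w <= c by [].
have Gle m n : (m <= n)%N -> <<s G m >> `<=` <<s G n >>.
  elim: n => [|n ih]; first by rewrite leqn0 => /eqP ->.
  rewrite leq_eqVlt => /orP[/eqP -> //|mn] E GE.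
  by apply: Gmono; apply: ih.
have GF N : <<s G N >> (F N).
  apply: (@bigcap_measurable _ (g_sigma_algebraType (G N))) => //.
    by exists 0%N.
  by move=> n /= nN; apply: (Gle n N nN); exact: gmeasurable_le.
have mF N : measurable (F N) by apply: (sigma_measurable (Gm N)).
have FS N w : F N.+1 w <-> F N w /\ M N.+1 w <= c.
  rewrite !FE; split=> [h|[h1 h2] n].
    by split=> [n nN|]; apply: h => //; exact: leqW.
  by rewrite leq_eqVlt => /orP[/eqP -> //|nN]; exact: h1.
have bMn n : bounded_mfun (M n).
  by split; [exact: (gmeasurable_measurable (Gm n))|exact: bM].
have b1F N : bounded_mfun (\1_(F N) : T -> R) by exact: bounded_mfun_indic.
have b1 N : bounded_mfun (fun w => c * (1 - \1_(F N) w)).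
  apply: bounded_mfunM; first exact: bounded_mfun_cst.
  by apply: bounded_mfunB => //; exact: bounded_mfun_cst.
have b2 N n : bounded_mfun (fun w => \1_(F N) w * M n w) by exact: bounded_mfunM.
have stopped_le1 N : \int[P]_w (c * (1 - \1_(F N) w) + \1_(F N) w * M N w) <= 1.
  elim: N => [|N ih].
    rewrite -[leRHS](mean_cst P); apply: le_mean.
    - exact: bounded_mfunD.
    - exact: bounded_mfun_cst.
    - move=> w; rewrite indicE; have [/set_mem Fw|/negP Fw] := boolP (w \in F 0%N).
        by rewrite subrr mulr0 add0r mul1r M1.
      rewrite subr0 mulr1 mul0r addr0 leNgt; apply/negP => c1.
      by apply: Fw; apply: mem_set => -[|n]//= _; rewrite M1 ltW.
  apply: le_trans ih.
  (* On a path that first exceeds c at time N + 1 the left side counts c, less than [M N.+1];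
     elsewhere the two sides agree. The supermartingale property is then used on the event [F N]. *)
  apply: (@le_trans _ _ (\int[P]_w (c * (1 - \1_(F N) w) + \1_(F N) w * M N.+1 w))).
    apply: le_mean; [exact: bounded_mfunD|exact: bounded_mfunD|move=> w].
    rewrite !indicE; have [/set_mem/FS[FN Mc]|/negP FSw] := boolP (w \in F N.+1).
      by rewrite (mem_set FN).
    have [/set_mem FN|_] := boolP (w \in F N); last by [].
    rewrite subrr subr0 mulr0 mulr1 mul0r mul1r addr0 add0r.
    rewrite leNgt; apply/negP => Mc; apply: FSw; apply/mem_set/FS; split => //.
    exact: ltW.
  by rewrite !meanD// lerD2l; exact: superM.
have PF N : 1 - c^-1 <= fine (P (F N)).
  have := stopped_le1 N; rewrite meanD// meanZ; last first.
    by apply: bounded_mfunB => //; exact: bounded_mfun_cst.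
  rewrite meanB//; last exact: bounded_mfun_cst.
  rewrite mean_cst mean_indic//.
  have : 0 <= \int[P]_w (\1_(F N) w * M N w).
    by apply: Rintegral_ge0 => w _; rewrite mulr_ge0// indicE.
  move=> h0 h1.
  have : c * (1 - fine (P (F N))) <= 1 by lra.
  by rewrite mulrC -ler_pdivlMr// mul1r; lra.
have capE : [set w | forall n, M n w <= c] = \bigcap_N F N.
  apply/seteqP; split => w /= h; first by move=> N _ n _; exact: h.
  by move=> n; apply: (h n) => //=.
have mcap : measurable (\bigcap_N F N) by exact: bigcapT_measurable.
rewrite capE; split => //.
have cvgF : P \o F @ \oo --> P (\bigcap_N F N).
  apply: nonincreasing_cvg_mu => //.
    by rewrite (le_lt_trans (probability_le1 P _))// ltry.
  move=> m n mn; apply/subsetPset => w Fw i /= im; apply: Fw => /=.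
  exact: leq_trans im _.
have -> : P (\bigcap_N F N) = limn (P \o F) by apply/esym/cvg_lim.
apply: lime_ge; first by apply/cvg_ex; exists (P (\bigcap_N F N)).
near=> N.
rewrite /= -[leRHS]fineK ?lee_fin//.
exact: fin_num_measure.
Unshelve. all: by end_near. Qed.

Section BoundedGfun.
Context {d : measure_display} {T : measurableType d} {R : realType}.
Implicit Types (G : set (set T)) (f g : T -> R).

Definition bounded_gfun G f : Prop :=
  @bounded_mfun _ (g_sigma_algebraType G) R f.

Lemma bounded_gfun_sub G1 G2 f : <<s G1 >> `<=` <<s G2 >> ->
  bounded_gfun G1 f -> bounded_gfun G2 f.
Proof. by move=> G12 [mf bf]; split => //; exact: gmeasurable_sub mf. Qed.

Lemma bounded_gfun_mfun G f : G `<=` measurable ->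
  bounded_gfun G f -> bounded_mfun f.
Proof. by move=> Gm [mf bf]; split => //; exact: gmeasurable_measurable mf. Qed.

Lemma bounded_gfun_indic G E : <<s G >> E -> bounded_gfun G (\1_E).
Proof. by move=> GE; apply: bounded_mfun_indic. Qed.

Lemma measurable_funV_gt0 d' (S : measurableType d') (f : S -> R) :
  (forall w, 0 < f w) -> measurable_fun setT f -> measurable_fun setT (fun w => (f w)^-1).
Proof.
move=> f0 mf.
have -> : (fun w => (f w)^-1) = expR \o (fun w => - ln (f w)).
  by apply/funext => w; rewrite /= expRN lnK// posrE.
apply: measurableT_comp => //; apply: measurableT_comp => //.
exact: measurableT_comp.
Qed.

Lemma measurable_fun_sqrt d' (S : measurableType d') (f : S -> R) :
  measurable_fun setT f -> measurable_fun setT (fun w => Num.sqrt (f w)).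
Proof.
move=> mf; apply: (measurableT_comp (f := @Num.sqrt R)) => //.
by apply: continuous_measurable_fun; exact: sqrt_continuous.
Qed.

Lemma bounded_mfunV d' (S : measurableType d') (f : S -> R) (c : R) : 0 < c ->
  (forall w, c <= f w) -> measurable_fun setT f ->
  bounded_mfun (fun w => (f w)^-1).
Proof.
move=> c0 cf mf; have f0 w : 0 < f w by exact: lt_le_trans (cf w).
split; first exact: measurable_funV_gt0.
by exists c^-1 => w; rewrite ger0_norm ?invr_ge0 ?(ltW (f0 w))// lef_pV2 ?posrE.
Qed.

End BoundedGfun.

(** * The adaptive experiment *)

Section Filtration.
Context {R : realType} {dT : measure_display} {T : measurableType dT}
        {dX : measure_display} {Xs : measurableType dX}.
Variables (X : nat -> T -> Xs) (Y0 Y1 : nat -> T -> R) (A : nat -> T -> bool).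

(* Tuples X_s, Y_s(0), Y_s(1) with s < n, treatments A_s with s < m: two time
   bounds, so that treatments can be revealed one at a time under fixed tuples.
   The history (X_s, A_s, Y_s), s < t, is measurable for gen_past t t. *)
Definition gen_past (n m : nat) : set (set T) :=
  [set E | (exists s, (1 <= s < n)%N /\ exists B : set (Xs * R * R),
              measurable B /\ E = Ztuple X Y0 Y1 s @^-1` B) \/
           (exists s, (1 <= s < m)%N /\ exists b : bool, E = [set w | A s w = b])].

Lemma gen_past_sub n n' m m' : (n <= n')%N -> (m <= m')%N ->
  gen_past n m `<=` gen_past n' m'.
Proof.
move=> nn' mm' E [[s [/andP[s0 sn] H]]|[s [/andP[s0 sm] H]]].
  by left; exists s; rewrite s0 (leq_trans sn).
by right; exists s; rewrite s0 (leq_trans sm).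
Qed.

Lemma gen_past_HistTuples n m : gen_past n m `<=` gen_HistTuples X A Y0 Y1 m.
Proof.
move=> E [[s [/andP[s0 sn] H]]|H]; first by left; exists s.
by right.
Qed.

Lemma Ztuple_past n m s : (1 <= s < n)%N ->
  measurable_fun (setT : set (g_sigma_algebraType (gen_past n m))) (Ztuple X Y0 Y1 s).
Proof.
move=> sn _ B mB; rewrite setTI; apply: sub_sigma_algebra.
by left; exists s; split => //; exists B.
Qed.

Lemma Y1_past n m s : (1 <= s < n)%N -> gmeasurable (gen_past n m) (Y1 s).
Proof.
by move=> sn; exact: (measurableT_comp measurable_snd (Ztuple_past sn)).
Qed.

Lemma Y0_past n m s : (1 <= s < n)%N -> gmeasurable (gen_past n m) (Y0 s).
Proof.
move=> sn; apply: (measurableT_comp measurable_snd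
  (measurableT_comp measurable_fst (Ztuple_past sn))).
Qed.

Lemma X_past n m s : (1 <= s < n)%N ->
  measurable_fun (setT : set (g_sigma_algebraType (gen_past n m))) (X s).
Proof.
move=> sn; apply: (measurableT_comp measurable_fst
  (measurableT_comp measurable_fst (Ztuple_past sn))).
Qed.

Lemma treatment_past n m s : (1 <= s < m)%N -> <<s gen_past n m >> [set w | A s w].
Proof.
by move=> sm; apply: sub_sigma_algebra; right; exists s; split => //; exists true.
Qed.

(** X_t belongs to tuple t, hence the tuple bound t + 1; the treatment bound stays at t, so A_t is
    not revealed. *)
Lemma gen_XtHist_past t : (0 < t)%N ->
  <<s gen_XtHist X A Y0 Y1 t >> `<=` <<s gen_past t.+1 t >>.
Proof.
move=> t0; apply: sigma_sub => E [[B [mB ->]]|[s [/andP[s0 st] H]]].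
  by rewrite -[X in <<s _ >> X]setTI; apply: X_past => //; rewrite t0 /=.
have st1 : (1 <= s < t.+1)%N by rewrite s0 leqW.
have st0 : (1 <= s < t)%N by rewrite s0.
case: H => [[B [mB ->]]|[[b ->]|[B [mB ->]]]].
- by rewrite -[X in <<s _ >> X]setTI; apply: X_past.
- by apply: sub_sigma_algebra; right; exists s; split => //; exists b.
- suff /gmeasurableP : gmeasurable (gen_past t.+1 t) (Yobs A Y0 Y1 s) by exact.
  apply: (@measurable_fun_ifT _ _ (g_sigma_algebraType (gen_past t.+1 t)) _ (Y1 s) (Y0 s) (A s));
    [|exact: Y1_past|exact: Y0_past].
  apply: (@measurable_fun_bool _ (g_sigma_algebraType (gen_past t.+1 t)) _ _ true).
  rewrite setTI; exact: treatment_past.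
Qed.

End Filtration.

(** Complements are covered because D has mean 0, disjoint unions by countable additivity.
    Independence can then be checked on a pi-system. *)
Lemma dynkin_mean_eq0 {d : measure_display} {T : measurableType d} {R : realType}
  (P : probability T R) (D : T -> R) : bounded_mfun D -> \int[P]_w D w = 0 ->
  dynkin [set E | measurable E /\ \int[P]_w (\1_E w * D w) = 0].
Proof.
move=> bD D0; split.
- split; first exact: measurableT.
  by rewrite -[RHS]D0; apply: eq_Rintegral => w _; rewrite indicT mul1r.
- move=> E [mE E0]; split; first exact: measurableC.
  have bED : bounded_mfun (fun w => \1_E w * D w).
    by apply: bounded_mfunM => //; exact: bounded_mfun_indic.
  transitivity (\int[P]_w (D w - \1_E w * D w)).
    apply: eq_Rintegral => w _.
    by rewrite !indicE in_setC; case: (w \in E) => /=; ring.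
  by rewrite meanB// D0 E0 subrr.
- move=> F tF FE; have mF n : measurable (F n) := (FE n).1.
  have mU : measurable (\bigcup_n F n) by exact: bigcup_measurable.
  split=> //.
  have iD := bounded_mfun_integrable P bD.
  have mkc (E : set T) : \int[P]_w (\1_E w * D w) = \int[P]_(w in E) D w.
    rewrite [RHS]Rintegral_mkcond; apply: eq_Rintegral => w _.
    by rewrite patchE indicE; case: ifP => _; rewrite ?mul1r ?mul0r.
  rewrite mkc /Rintegral integral_bigcup//; last exact: integrableS iD.
  rewrite eseries0// => n _ _.
  have : \int[P]_(w in F n) D w = 0 by rewrite -mkc; exact: (FE n).2.
  have iF : P.-integrable (F n) (EFin \o D) by exact: integrableS iD.
  rewrite /Rintegral => h.
  by rewrite -[LHS]fineK ?h//; exact: integrable_fin_num.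
Qed.

(** * Randomisation, and independence of the current tuple from the past *)

Section AdaptiveExperiment.
Context {R : realType} {dT : measure_display} {T : measurableType dT}
        {dX : measure_display} {Xs : measurableType dX}.
Variables (X : nat -> T -> Xs) (Y0 Y1 : nat -> T -> R) (A : nat -> T -> bool).
Variables (P : probability T R) (p : nat -> T -> R).
Hypothesis Hiid : iid_tuples P (Ztuple X Y0 Y1).
Hypothesis HA : forall t, (0 < t)%N -> measurable [set w | A t w].
Hypothesis Hp01 : forall t w, (0 < t)%N -> 0 <= p t w <= 1.
Hypothesis Hpm : forall t, (0 < t)%N -> gmeasurable (gen_XtHist X A Y0 Y1 t) (p t).
Hypothesis Hrand : forall t, (0 < t)%N -> forall E : set T,
  <<s gen_HistTuples X A Y0 Y1 t >> E ->
  P (E `&` [set w | A t w]) = (\int[P]_(w in E) (p t w)%:E)%E.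

Local Notation Z := (Ztuple X Y0 Y1).
Local Notation past := (gen_past X Y0 Y1 A).

Lemma HistTuples_measurable t : gen_HistTuples X A Y0 Y1 t `<=` measurable.
Proof.
have mZ s : measurable_fun setT (Z s) by case: Hiid.
move=> E [[s [s0 [B [mB ->]]]]|[s [/andP[s0 _] [b ->]]]].
  by rewrite -[X in measurable X]setTI; exact: mZ.
case: b; first exact: HA.
have -> : [set w | A s w = false] = ~` [set w | A s w].
  by apply/seteqP; split => w /=; [move=> -> | move/negP/negbTE].
by apply: measurableC; exact: HA.
Qed.

Lemma past_measurable n m : past n m `<=` measurable.
Proof.
by move=> E /gen_past_HistTuples; exact: HistTuples_measurable.
Qed.

Lemma propensity_past n t : (0 < t < n)%N -> bounded_gfun (past n t) (p t).
Proof.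
move=> /andP[t0 tn]; split; last first.
  by exists 1 => w; have /andP[p0 p1] := Hp01 w t0; rewrite ger0_norm.
apply: gmeasurable_sub (Hpm t0) => E /gen_XtHist_past - /(_ t0).
by apply: sigma_sub => F /(gen_past_sub tn (leqnn t)); exact: sub_sigma_algebra.
Qed.

Lemma past_sub_HistTuples n t : <<s past n t >> `<=` <<s gen_HistTuples X A Y0 Y1 t >>.
Proof.
by apply: sigma_sub => E /gen_past_HistTuples; exact: sub_sigma_algebra.
Qed.

(** [V] may involve the potential outcomes of time t and even later tuples, because [Hrand]
    conditions on all of them. The inverse weighting uses the former, the independence argument the
    latter. *)
Lemma mean_treatment t V : (0 < t)%N -> bounded_gfun (gen_HistTuples X A Y0 Y1 t) V ->
  \int[P]_w (V w * \1_[set w | A t w] w) = \int[P]_w (V w * p t w).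
Proof.
move=> t0 bV.
have HmT := @HistTuples_measurable t.
have bVm := bounded_gfun_mfun HmT bV.
have bA : bounded_mfun (\1_[set w | A t w] : T -> R) := bounded_mfun_indic (HA t0).
have bp : bounded_mfun (p t).
  by apply: (@bounded_gfun_mfun _ _ _ (past t.+1 t)); [exact: past_measurable|
    apply: propensity_past; rewrite t0/=].
have bD := bounded_mfunB bA bp.
apply/eqP; rewrite -subr_eq0 -meanB; [|exact: bounded_mfunM|exact: bounded_mfunM].
apply/eqP; under eq_Rintegral do rewrite -mulrBr.
apply: (mean_mul_eq0 HmT bD bV.1 bV.2) => E GE.
have mE : measurable E by exact: (sigma_measurable HmT).
have bE : bounded_mfun (\1_E : T -> R) by exact: bounded_mfun_indic.
under eq_Rintegral do rewrite mulrBr.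
rewrite meanB; [|exact: bounded_mfunM|exact: bounded_mfunM].
have -> : \int[P]_w (\1_E w * \1_[set w0 | A t w0] w) = fine (P (E `&` [set w | A t w])).
  rewrite -mean_indic; last by apply: measurableI => //; exact: HA.
  by apply: eq_Rintegral => w _; rewrite indicI.
rewrite Hrand// -/(Rintegral P E (p t)) (Rintegral_mkcond P E).
apply/eqP; rewrite subr_eq0; apply/eqP; apply: eq_Rintegral => w _.
by rewrite patchE indicE; case: ifP => _; rewrite ?mul1r ?mul0r.
Qed.

(** A zero integral against the indicator of E says that E is independent of the event that tuple n
    lies in C; this is the form that [mean_mul_eq0] extends to functions. *)
Definition centred_event n (C : set (Xs * R * R)) (w : T) : R :=
  \1_(Z n @^-1` C) w - fine (P (Z n @^-1` C)).

Lemma preimage_measurable n C : measurable C -> measurable (Z n @^-1` C).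
Proof.
move=> mC; rewrite -[X in measurable X]setTI.
by case: Hiid => mZ _; exact: mZ.
Qed.

Lemma bounded_centred_event n C : measurable C -> bounded_mfun (centred_event n C).
Proof.
move=> mC; apply: bounded_mfunB; last exact: bounded_mfun_cst.
by apply: bounded_mfun_indic; exact: preimage_measurable.
Qed.

(** With treatment bound 1 no treatment is revealed: rectangles in the first n - 1 tuples form a
    generating pi-system, on which the product formula of [iid_tuples] applies. *)
Lemma tuples_independent n C E : (0 < n)%N -> measurable C ->
  <<s past n 1 >> E -> \int[P]_w (\1_E w * centred_event n C w) = 0.
Proof.
move=> n0 mC.
pose rect (B : nat -> set (Xs * R * R)) := \big[setI/setT]_(s <- iota 1 n.-1) (Z s @^-1` B s).
pose G := [set E | exists B, (forall s, measurable (B s)) /\ E = rect B].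
have rectE B w : rect B w <-> forall s, (1 <= s < n)%N -> B s (Z s w).
  rewrite /rect -bigcap_seq; split=> h s.
    by move=> sn; apply: (h s); rewrite /= mem_iota add1n prednK.
  by rewrite /= mem_iota add1n prednK//; exact: h.
have GI : setI_closed G.
  move=> _ _ [B1 [mB1 ->]] [B2 [mB2 ->]]; exists (fun s => B1 s `&` B2 s).
  split; first by move=> s; exact: measurableI.
  apply/seteqP; split => w.
    by move=> [/rectE h1 /rectE h2]; apply/rectE => s sn; split; [exact: h1|exact: h2].
  by move/rectE => h; split; apply/rectE => s /h [].
have pastG : <<s past n 1 >> `<=` <<s G >>.
  apply: sigma_sub => F [[s [sn [B [mB ->]]]]|[s [/andP[s0 s1] _]]]; last first.
    by move: s1; rewrite ltnS leqNgt s0.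
  apply: sub_sigma_algebra.
  exists (fun i => if i == s then B else setT); split.
    by move=> i; case: ifP => _ //; exact: measurableT.
  apply/seteqP; split => w.
    by move=> h; apply/rectE => i _; case: eqP => // ->.
  by move/rectE => /(_ s sn); rewrite eqxx.
move=> /pastG; rewrite -setI_closed_g_dynkin_g_sigma_algebra//.
have bD := bounded_centred_event n mC.
have mZ := preimage_measurable n mC.
have bZ : bounded_mfun (\1_(Z n @^-1` C) : T -> R) by exact: bounded_mfun_indic.
have D0 : \int[P]_w centred_event n C w = 0.
  rewrite /centred_event meanB//; last exact: bounded_mfun_cst.
  by rewrite mean_cst mean_indic// subrr.
have dyn := dynkin_mean_eq0 bD D0.
move=> GE; suff [] : [set E | measurable E /\
  \int[P]_w (\1_E w * centred_event n C w) = 0] E by [].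
apply: GE; split => // _ [B [mB ->]].
have mR : measurable (rect B).
  apply: bigsetI_measurable => s _; exact: preimage_measurable.
have b1 : bounded_mfun (\1_(rect B) : T -> R) by exact: bounded_mfun_indic.
split => //; rewrite /centred_event.
under eq_Rintegral do rewrite mulrBr.
rewrite meanB; [|exact: bounded_mfunM|apply: bounded_mfunM => //; exact: bounded_mfun_cst].
under [X in _ - X]eq_Rintegral do rewrite mulrC.
rewrite meanZ// mean_indic//.
have -> : \int[P]_w (\1_(rect B) w * \1_(Z n @^-1` C) w) = fine (P (rect B `&` Z n @^-1` C)).
  rewrite -mean_indic; last exact: measurableI.
  by apply: eq_Rintegral => w _; rewrite indicI.
case: Hiid => _ [prodZ _].
have uI : uniq (iota 1 n.-1) := iota_uniq _ _.
have aI : all (fun s => 0 < s)%N (iota 1 n.-1) by apply/allP => s; rewrite mem_iota => /andP[].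
have nI : n \notin iota 1 n.-1 by rewrite mem_iota add1n prednK// ltnn andbF.
have h1 := prodZ _ B uI aI mB.
pose B' s := if s == n then C else B s.
have uI' : uniq (n :: iota 1 n.-1) by rewrite /= nI.
have aI' : all (fun s => 0 < s)%N (n :: iota 1 n.-1) by rewrite /= n0.
have mB' s : measurable (B' s) by rewrite /B'; case: ifP.
have h2 := prodZ _ B' uI' aI' mB'.
have eqB (I : Type) (idx : I) (op : I -> I -> I) (F : nat -> set (Xs * R * R) -> I) :
  \big[op/idx]_(s <- iota 1 n.-1) F s (B' s) = \big[op/idx]_(s <- iota 1 n.-1) F s (B s).
  apply: eq_big_seq => s sI; rewrite /B'; case: eqP => // sn.
  by exfalso; move/negP: nI; apply; rewrite -{1}sn.
rewrite !big_cons (eqB _ _ _ (fun s b => Z s @^-1` b)) in h2.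
rewrite (eqB _ _ _ (fun s b => fine (P (Z s @^-1` b)))) in h2.
rewrite /B' eqxx in h2.
by rewrite setIC /rect h2 h1 /= subrr.
Qed.

(** Sets of this form already make up a sigma-algebra: complements and countable unions act
    separately on the two halves. *)
Lemma past_step n m E : <<s past n m.+1 >> E -> (0 < m)%N ->
  exists E1 E2, [/\ <<s past n m >> E1, <<s past n m >> E2 &
    E = (E1 `&` [set w | A m w]) `|` (E2 `&` ~` [set w | A m w])].
Proof.
move=> GE m0.
pose L := [set E | exists E1 E2, [/\ <<s past n m >> E1, <<s past n m >> E2 &
    E = (E1 `&` [set w | A m w]) `|` (E2 `&` ~` [set w | A m w])]].
have sub E0 : <<s past n m >> E0 -> L E0.
  by move=> h; exists E0, E0; split => //; rewrite -setIUr setUv setIT.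
suff : <<s past n m.+1 >> `<=` L by exact.
apply: smallest_sub; last first.
  move=> F [H|[s [/andP[s0]]]].
    by apply: sub; apply: sub_sigma_algebra; left.
  rewrite ltnS leq_eqVlt => /orP[/eqP ->|sm] [b ->]; last first.
    apply: sub; apply: sub_sigma_algebra; right; exists s; rewrite s0 sm; split => //.
    by exists b.
  case: b.
    exists setT, set0; split; [exact: (@measurableT _ (g_sigma_algebraType _))|
      exact: sigma_algebra0|by rewrite set0I setTI setU0].
  exists set0, setT; split; [exact: sigma_algebra0|
    exact: (@measurableT _ (g_sigma_algebraType _))|].
  rewrite set0I setTI set0U; apply/seteqP; split => w /=; first by move=> ->.
  by move/negP/negbTE.
split.
- by apply: sub; exact: sigma_algebra0.
- move=> F [E1 [E2 [h1 h2 ->]]]; rewrite setTD.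
  exists (~` E1), (~` E2); split; [exact: sigma_algebraC|exact: sigma_algebraC|].
  apply/seteqP; split => w /=; have [a|a] := pselect (A m w : Prop); tauto.
- move=> F FL.
  have /choice [E1 /choice [E2 H]] := FL.
  exists (\bigcup_i E1 i), (\bigcup_i E2 i); split.
  + by apply: sigma_algebra_bigcup => i; case: (H i).
  + by apply: sigma_algebra_bigcup => i; case: (H i).
  + rewrite !setI_bigcupl -bigcupU; apply: eq_bigcupr => i _.
    by case: (H i).
Qed.

(** Induction on the revealed treatments. By [mean_treatment] the indicator of A_m = 1 becomes the
    propensity, even next to an event of tuple n. The propensity depends only on the past without
    A_m, and [mean_mul_eq0] extends the induction hypothesis to it. *)
Lemma past_independent n m C E : (0 < m <= n)%N -> measurable C ->
  <<s past n m >> E -> \int[P]_w (\1_E w * centred_event n C w) = 0.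
Proof.
move=> + mC; elim: m E => [//|m ih] E /andP[_ mn].
have [m0|m0] := posnP m; first by rewrite m0; apply: tuples_independent => //; lia.
have bD := bounded_centred_event n mC.
have {}ih E0 : <<s past n m >> E0 -> \int[P]_w (\1_E0 w * centred_event n C w) = 0.
  by apply: ih; rewrite m0 ltnW.
have treated E0 : <<s past n m >> E0 ->
    \int[P]_w (\1_E0 w * centred_event n C w * \1_[set w | A m w] w) = 0.
  move=> GE0; rewrite mean_treatment//; last first.
    apply: bounded_mfunM.
      by apply: bounded_gfun_indic; exact: past_sub_HistTuples GE0.
    apply: bounded_mfunB; last exact: bounded_mfun_cst.
    apply: bounded_gfun_indic; apply: sub_sigma_algebra; left; exists n.
    by split; [lia|exists C].
  have bW : bounded_gfun (past n m) (fun w => \1_E0 w * p m w).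
    apply: bounded_mfunM; first exact: bounded_gfun_indic.
    by apply: propensity_past; rewrite m0.
  rewrite -[RHS](mean_mul_eq0 (@past_measurable n m) bD bW.1 bW.2 ih).
  by apply: eq_Rintegral => w _; ring.
move=> /past_step /(_ m0) [E1 [E2 [h1 h2 ->]]].
have mE E0 : <<s past n m >> E0 -> bounded_mfun (\1_E0 : T -> R).
  by move=> ?; apply: bounded_mfun_indic; exact: (sigma_measurable (@past_measurable n m)).
have bA : bounded_mfun (\1_[set w | A m w] : T -> R) := bounded_mfun_indic (HA m0).
have b1 := bounded_mfunM (mE _ h1) bD.
have b2 := bounded_mfunM (mE _ h2) bD.
transitivity (\int[P]_w (\1_E1 w * centred_event n C w * \1_[set w | A m w] w +
  (\1_E2 w * centred_event n C w -
   \1_E2 w * centred_event n C w * \1_[set w | A m w] w))).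
  apply: eq_Rintegral => w _; rewrite !indicE in_setU !in_setI in_setC.
  by case: (w \in [set w0 | A m w0]); case: (w \in E1); case: (w \in E2); rewrite /=; ring.
rewrite meanD; [|exact: bounded_mfunM|apply: bounded_mfunB => //; exact: bounded_mfunM].
rewrite meanB//; last exact: bounded_mfunM.
by rewrite !treated// ih// subrr addr0.
Qed.

(** Independence of events passes to functions by two uses of [mean_mul_eq0]: one replaces events of
    the past by W, the other ([key]) replaces events of tuple n by g (Z n), with the indicator of E
    as the centred factor. *)
Lemma mean_future (n : nat) (g : Xs * R * R -> R) (W : T -> R) : (0 < n)%N ->
  bounded_mfun g -> bounded_gfun (past n n) W ->
  \int[P]_w (W w * g (Z n w)) = \int[P]_w W w * \int[P]_w g (Z n w).
Proof.
move=> n0 bg bW.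
have mZn : measurable_fun setT (Z n) by case: Hiid.
have bgZ : bounded_mfun (fun w => g (Z n w)).
  split; first exact: (measurableT_comp bg.1 mZn).
  by have [C gC] := bg.2; exists C => w; exact: gC.
pose c := \int[P]_w g (Z n w).
have bD : bounded_mfun (fun w => g (Z n w) - c).
  by apply: bounded_mfunB => //; exact: bounded_mfun_cst.
have pm := @past_measurable n n.
have bWm := bounded_gfun_mfun pm bW.
apply/eqP; rewrite -/c mulrC -meanZ// -subr_eq0 -meanB; [|exact: bounded_mfunM|
  apply: bounded_mfunM => //; exact: bounded_mfun_cst].
apply/eqP; transitivity (\int[P]_w (W w * (g (Z n w) - c))).
  by apply: eq_Rintegral => w _; ring.
apply: (mean_mul_eq0 pm bD bW.1 bW.2) => E GE.
have mE : measurable E by exact: (sigma_measurable pm).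
have bE : bounded_mfun (\1_E : T -> R) by exact: bounded_mfun_indic.
pose GZ := [set F | exists B : set (Xs * R * R), measurable B /\ F = Z n @^-1` B].
have GZm : GZ `<=` measurable by move=> F [B [mB ->]]; exact: preimage_measurable.
have gE (F : set T) : <<s GZ >> F -> GZ F.
  suff : <<s GZ >> `<=` GZ by exact.
  apply: smallest_sub => //; split.
  - by exists set0; split => //; rewrite preimage_set0.
  - move=> F0 [B [mB ->]]; exists (~` B); split; first exact: measurableC.
    by rewrite setTD preimage_setC.
  - move=> F0 /choice [B FB]; exists (\bigcup_i B i); split.
      by apply: bigcup_measurable => i _; case: (FB i).
    by rewrite preimage_bigcup; apply: eq_bigcupr => i _; case: (FB i).
have bE' : bounded_mfun (fun w => \1_E w - fine (P E)).
  by apply: bounded_mfunB => //; exact: bounded_mfun_cst.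
have gg : gmeasurable GZ (fun w => g (Z n w)).
  apply/gmeasurableP => B mB; apply: sub_sigma_algebra.
  exists (g @^-1` B); split => //.
  by rewrite -[X in measurable X]setTI; exact: bg.1.
have key : \int[P]_w (g (Z n w) * (\1_E w - fine (P E))) = 0.
  apply: (mean_mul_eq0 GZm bE' gg bgZ.2) => _ /gE [B [mB ->]].
  have nn : (0 < n <= n)%N by rewrite n0 leqnn.
  have := past_independent nn mB GE; rewrite /centred_event.
  have mB' := preimage_measurable n mB.
  have bB : bounded_mfun (\1_(Z n @^-1` B) : T -> R) by exact: bounded_mfun_indic.
  under eq_Rintegral do rewrite mulrBr.
  under [in X in _ -> X]eq_Rintegral do rewrite mulrBr.
  have bc (f : T -> R) (r : R) : bounded_mfun f -> bounded_mfun (fun w => f w * r).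
    by move=> bf; apply: bounded_mfunM => //; exact: bounded_mfun_cst.
  rewrite !meanB; [|exact: bounded_mfunM|exact: bc|exact: bounded_mfunM|exact: bc].
  rewrite !RintegralZr//; [|exact: bounded_mfun_integrable|exact: bounded_mfun_integrable].
  rewrite !mean_indic// => h; rewrite -[RHS]h [X in _ - X = _]mulrC; congr (_ - _).
  by apply: eq_Rintegral => w _; rewrite mulrC.
have : \int[P]_w (g (Z n w) * \1_E w) = c * fine (P E).
  apply/eqP; rewrite -subr_eq0 -[X in _ == X]key; apply/eqP.
  rewrite /c -RintegralZr//; last exact: bounded_mfun_integrable.
  rewrite -meanB; [|exact: bounded_mfunM|apply: bounded_mfunM => //; exact: bounded_mfun_cst].
  by apply: eq_Rintegral => w _; ring.
move=> h; transitivity (\int[P]_w (g (Z n w) * \1_E w - c * \1_E w)).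
  by apply: eq_Rintegral => w _; ring.
rewrite meanB; [|exact: bounded_mfunM|apply: bounded_mfunM => //; exact: bounded_mfun_cst].
by rewrite meanZ// mean_indic// h subrr.
Qed.

Lemma mean_identically_distributed (n : nat) (g : Xs * R * R -> R) : (0 < n)%N ->
  bounded_mfun g -> \int[P]_w g (Z n w) = \int[P]_w g (Z 1%N w).
Proof.
move=> n0 bg; case: Hiid => mZ [_ idZ].
have push m : \int[P]_w g (Z m w) = fine (\int[pushforward P (Z m)]_y (g y)%:E)%E.
  rewrite integral_pushforward//.
  - by apply/measurable_EFinP; case: bg.
  - apply: (@bounded_mfun_integrable _ _ _ P (g \o Z m)).
    split; first exact: (measurableT_comp bg.1 (mZ m)).
    by have [C gC] := bg.2; exists C => w; exact: gC.
rewrite !push; congr fine; apply: eq_measure_integral => B mB _.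
exact: idZ.
Qed.

(** * Conditional mean and range of the AIPW terms *)

Variables (f : nat -> bool -> T -> R) (k : nat -> R).
Hypothesis HY : forall t w, (0 < t)%N -> 0 <= Y0 t w <= 1 /\ 0 <= Y1 t w <= 1.
Hypothesis Hk : forall t, (0 < t)%N -> 2 <= k t.
Hypothesis Hp : forall t w, (0 < t)%N -> (k t)^-1 <= p t w <= 1 - (k t)^-1.
Hypothesis Hf01 : forall t a w, (0 < t)%N -> 0 <= f t a w <= 1.
Hypothesis Hfm : forall t a, (0 < t)%N -> gmeasurable (gen_XtHist X A Y0 Y1 t) (f t a).

Lemma indic_bool (a : T -> bool) w : \1_[set v | a v] w = (a w)%:R :> R.
Proof.
rewrite indicE; congr ((nat_of_bool _)%:R).
by apply/idP/idP => [/set_mem|h] //; exact: mem_set.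
Qed.

(* hAIPW with the propensity and outcome estimates as processes p t and f t a. *)
Definition aipw (t : nat) (w : T) : R :=
  (if A t w then (Yobs A Y0 Y1 t w - f t true w) / p t w else 0) -
  (if A t w then 0 else (Yobs A Y0 Y1 t w - f t false w) / (1 - p t w)) +
  f t true w - f t false w.

Definition ate : R := \int[P]_w (Y1 1%N w - Y0 1%N w).

Lemma Xt_past n t (g : T -> R) : (0 < t < n)%N ->
  gmeasurable (gen_XtHist X A Y0 Y1 t) g -> gmeasurable (past n t) g.
Proof.
move=> /andP[t0 tn]; apply: gmeasurable_sub => E /gen_XtHist_past - /(_ t0).
by apply: sigma_sub => F /(gen_past_sub tn (leqnn t)); exact: sub_sigma_algebra.
Qed.

Lemma kinv_gt0 t : (0 < t)%N -> 0 < (k t)^-1.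
Proof. by move=> /Hk ?; rewrite invr_gt0; lra. Qed.

Lemma outcome_bounded n m t (b : bool) : (0 < t < n)%N ->
  bounded_gfun (past n m) (if b then Y1 t else Y0 t).
Proof.
move=> /andP[t0 tn]; split.
  by case: b; [apply: Y1_past|apply: Y0_past]; rewrite t0.
by exists 1 => w; have [/andP[a1 a2] /andP[a3 a4]] := HY w t0; case: b; rewrite ger0_norm.
Qed.

Lemma estimator_bounded n t a : (0 < t < n)%N -> bounded_gfun (past n t) (f t a).
Proof.
move=> tn; split; first by apply: Xt_past => //; apply: Hfm; case/andP: tn.
exists 1 => w; have /andP[t0 _] := tn.
by have /andP[a0 a1] := Hf01 a w t0; rewrite ger0_norm.
Qed.

Lemma invp_bounded n t : (0 < t < n)%N -> bounded_gfun (past n t) (fun w => (p t w)^-1).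
Proof.
move=> tn; have /andP[t0 _] := tn.
apply: (@bounded_mfunV R _ _ _ (k t)^-1); first exact: kinv_gt0.
  by move=> w; case/andP: (Hp w t0).
by have [] := propensity_past tn.
Qed.

Lemma inv1p_bounded n t : (0 < t < n)%N ->
  bounded_gfun (past n t) (fun w => (1 - p t w)^-1).
Proof.
move=> tn; have /andP[t0 _] := tn.
apply: (@bounded_mfunV R _ _ _ (k t)^-1); first exact: kinv_gt0.
  by move=> w; have /andP[h1 h2] := Hp w t0; lra.
by case: (bounded_mfunB (@bounded_mfun_cst _ (g_sigma_algebraType (past n t)) R 1)
  (propensity_past tn)).
Qed.

(** Outcomes are known to lie in [0, 1] along the sample paths, while [mean_future] asks for a
    function bounded on the whole product space; clipping changes nothing on the paths. *)
Definition clip (y : R) : R := Num.min (Num.max y 0) 1.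

Lemma clip_id y : 0 <= y <= 1 -> clip y = y.
Proof. by move=> /andP[y0 y1]; rewrite /clip max_l// min_l. Qed.

Lemma bounded_effect : bounded_mfun (fun z : Xs * R * R => clip z.2 - clip z.1.2).
Proof.
have mclip d' (S : measurableType d') (g : S -> R) : measurable_fun setT g ->
    bounded_mfun (fun w => clip (g w)).
  move=> mg; split.
    apply: measurable_minr; last exact: measurable_cst.
    by apply: measurable_maxr => //; exact: measurable_cst.
  exists 1 => w; rewrite ger0_norm /clip ?ge_min ?lexx ?orbT//.
  by rewrite le_min le_max lexx orbT ler01.
apply: bounded_mfunB; apply: mclip; first exact: measurable_snd.
by apply: (measurableT_comp measurable_snd); exact: measurable_fst.
Qed.

Lemma mean_effect t W : (0 < t)%N -> bounded_gfun (past t t) W ->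
  \int[P]_w (W w * (Y1 t w - Y0 t w)) = ate * \int[P]_w W w.
Proof.
move=> t0 bW.
have effE s w : (0 < s)%N ->
    Y1 s w - Y0 s w = clip (Z s w).2 - clip (Z s w).1.2.
  by move=> s0; have [h0 h1] := HY w s0; rewrite !clip_id.
under eq_Rintegral do rewrite (effE t _ t0).
rewrite (mean_future t0 bounded_effect bW) mulrC; congr (_ * _).
rewrite (mean_identically_distributed t0 bounded_effect) /ate.
by apply: eq_Rintegral => w _; rewrite effE.
Qed.

Lemma aipw_past t : (0 < t)%N -> bounded_gfun (past t.+1 t.+1) (aipw t).
Proof.
move=> t0; have tt : (0 < t < t.+1)%N by rewrite t0 /=.
have up (g : T -> R) : bounded_gfun (past t.+1 t) g -> bounded_gfun (past t.+1 t.+1) g.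
  apply: bounded_gfun_sub; apply: sigma_sub => E.
  by move/(gen_past_sub (leqnn _) (leqnSn t)); exact: sub_sigma_algebra.
have bA : bounded_gfun (past t.+1 t.+1) (\1_[set w | A t w] : T -> R).
  by apply: bounded_gfun_indic; apply: treatment_past; rewrite t0/=.
have b1 := up _ (estimator_bounded true tt).
have b0 := up _ (estimator_bounded false tt).
have by1 := @outcome_bounded t.+1 t.+1 t true tt.
have by0 := @outcome_bounded t.+1 t.+1 t false tt.
have bp := up _ (invp_bounded tt).
have bq := up _ (inv1p_bounded tt).
have -> : aipw t = (fun w => \1_[set w | A t w] w * ((Y1 t w - f t true w) * (p t w)^-1)
   - (1 - \1_[set w | A t w] w) * ((Y0 t w - f t false w) * (1 - p t w)^-1)
   + f t true w - f t false w).
  apply/funext => w; rewrite /aipw /Yobs indic_bool.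
  by case: (A t w); rewrite /= ?subrr ?subr0 ?mul0r ?mul1r ?subr0.
apply: bounded_mfunB => //; apply: bounded_mfunD => //; apply: bounded_mfunB.
  by apply: bounded_mfunM => //; apply: bounded_mfunM => //; exact: bounded_mfunB.
apply: bounded_mfunM; first by apply: bounded_mfunB => //; exact: bounded_mfun_cst.
by apply: bounded_mfunM => //; exact: bounded_mfunB.
Qed.

Lemma mean_aipw t W : (0 < t)%N -> bounded_gfun (past t t) W ->
  \int[P]_w (W w * aipw t w) = ate * \int[P]_w W w.
Proof.
move=> t0 bW; have tt : (0 < t < t.+1)%N by rewrite t0 /=.
have upW : bounded_gfun (past t.+1 t) W.
  apply: bounded_gfun_sub bW; apply: sigma_sub => E.
  by move/(gen_past_sub (leqnSn t) (leqnn _)); exact: sub_sigma_algebra.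
have b1 := estimator_bounded true tt.
have b0 := estimator_bounded false tt.
have by1 := @outcome_bounded t.+1 t t true tt.
have by0 := @outcome_bounded t.+1 t t false tt.
have bp := invp_bounded tt.
have bq := inv1p_bounded tt.
pose V1 w := W w * ((Y1 t w - f t true w) * (p t w)^-1).
pose V0 w := W w * ((Y0 t w - f t false w) * (1 - p t w)^-1).
have bV1 : bounded_gfun (past t.+1 t) V1.
  by apply: bounded_mfunM => //; apply: bounded_mfunM => //; exact: bounded_mfunB.
have bV0 : bounded_gfun (past t.+1 t) V0.
  by apply: bounded_mfunM => //; apply: bounded_mfunM => //; exact: bounded_mfunB.
have bV : bounded_gfun (past t.+1 t) (fun w => V1 w + V0 w) by exact: bounded_mfunD.
have bR : bounded_gfun (past t.+1 t) (fun w => W w * (f t true w - f t false w) - V0 w).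
  by apply: bounded_mfunB => //; apply: bounded_mfunM => //; exact: bounded_mfunB.
have low (g : T -> R) : bounded_gfun (past t.+1 t) g -> bounded_mfun g.
  by apply: bounded_gfun_mfun; exact: past_measurable.
have bA : bounded_mfun (\1_[set w | A t w] : T -> R) := bounded_mfun_indic (HA t0).
rewrite -(mean_effect t0 bW).
(* Regrouped as a multiple of the treatment indicator plus a remainder free of A_t. Replacing the
   indicator by p cancels both inverse weights and leaves W (Y1 - Y0). *)
transitivity (\int[P]_w ((V1 w + V0 w) * \1_[set w | A t w] w +
    (W w * (f t true w - f t false w) - V0 w))).
  apply: eq_Rintegral => w _; rewrite /aipw /Yobs indic_bool /V1 /V0.
  by case: (A t w); rewrite /=; ring.
rewrite meanD; [|by apply: bounded_mfunM => //; exact: low|exact: low].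
rewrite mean_treatment//; last exact: bounded_gfun_sub (@past_sub_HistTuples _ _) bV.
rewrite -meanD; [|by apply: bounded_mfunM; apply: low => //; exact: propensity_past|exact: low].
apply: eq_Rintegral => w _; rewrite /V1 /V0.
have k0 := kinv_gt0 t0; have /andP[h1 h2] := Hp w t0.
field; apply/andP; split; apply/eqP; lra.
Qed.

Lemma ate_bound : -1 <= ate <= 1.
Proof.
have b1 : bounded_mfun (fun w => Y1 1%N w - Y0 1%N w).
  apply: (@bounded_gfun_mfun _ _ _ (past 2 1)); first exact: past_measurable.
  by apply: bounded_mfunB; [exact: (@outcome_bounded 2 1 1 true)|
    exact: (@outcome_bounded 2 1 1 false)].
rewrite -ler_norml; apply: norm_mean_le => // w.
have [/andP[? ?] /andP[? ?]] := HY w (ltn0Sn 0).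
by rewrite ler_norml; lra.
Qed.

(** The crude bound is k_t + 1; estimates in [0, 1] save the 1. The quotient (y - g) / q lies
    between - g K and (1 - g) K, so adding g - g' stays within K. The control arm is the same with
    the signs reversed. *)
Lemma aipw_bound t w : (0 < t)%N -> `|aipw t w| <= k t.
Proof.
have arm (K q y g g' : R) : 2 <= K -> K^-1 <= q <= 1 -> 0 <= y <= 1 -> 0 <= g <= 1 ->
    0 <= g' <= 1 -> `|(y - g) / q + g - g'| <= K.
  move=> K2 /andP[q0 q1] /andP[y0 y1] /andP[g0 g1] /andP[g'0 g'1].
  have Ki0 : 0 < K^-1 by rewrite invr_gt0; lra.
  have q_gt0 : 0 < q := lt_le_trans Ki0 q0.
  have r1 : 1 <= q^-1 by rewrite invf_ge1.
  have rK : q^-1 <= K by rewrite -[leRHS]invrK lef_pV2 ?posrE.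
  have h1 : (y - g) / q <= (1 - g) * K.
    have [yg|yg] := leP g y; first by apply: ler_pM; lra.
    apply: (@le_trans _ _ 0); last by rewrite mulr_ge0//; lra.
    by rewrite mulr_le0_ge0//; lra.
  have h2 : - (g * K) <= (y - g) / q.
    rewrite -lerN2 opprK -mulNr opprB.
    have [yg|yg] := leP y g; first by apply: ler_pM; lra.
    apply: (@le_trans _ _ 0); last by rewrite mulr_ge0//; lra.
    by rewrite mulr_le0_ge0//; lra.
  rewrite ler_norml; nra.
move=> t0; have K2 := Hk t0; have /andP[p0 p1] := Hp w t0.
have [hy0 hy1] := HY w t0; have kt0 := kinv_gt0 t0.
have hf1 := Hf01 true w t0; have hf0 := Hf01 false w t0.
rewrite /aipw /Yobs; case: (A t w); first by rewrite subr0; apply: arm => //; lra.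
rewrite sub0r.
have -> : - ((Y0 t w - f t false w) / (1 - p t w)) + f t true w - f t false w =
  - ((Y0 t w - f t false w) / (1 - p t w) + f t false w - f t true w) by ring.
by rewrite normrN; apply: arm => //; lra.
Qed.

(** * Ranges and predictability of the estimators *)

Variables (alpha sigma02 : R).
Hypothesis Halpha : 0 < alpha < 1.
Hypothesis Hsigma02 : 0 < sigma02.

Local Notation xi w t := (aipw t w / (k t + 1)).
Local Notation lam w t := (lambda alpha sigma02 k (fun i => xi w i) t).
Local Notation hat w t := (xihat k (fun i => xi w i) t).

Lemma k1_gt0 t : (0 < t)%N -> 0 < k t + 1.
Proof. by move=> /Hk ?; lra. Qed.

Lemma invk1_bounds t : (0 < t)%N -> 0 < (k t + 1)^-1 <= 1.
Proof.
by move=> t0; rewrite invr_gt0 k1_gt0// invf_le1 ?k1_gt0//=; have := Hk t0; lra.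
Qed.

Lemma xi_bounds t w : (0 < t)%N ->
  - (1 - (k t + 1)^-1) <= xi w t <= 1 - (k t + 1)^-1.
Proof.
move=> t0; rewrite -ler_norml normrM; have k1 := k1_gt0 t0.
rewrite normfV (gtr0_norm k1) ler_pdivrMr// mulrBl mul1r mulVf ?gt_eqF//.
by rewrite addrK; exact: aipw_bound.
Qed.

Lemma hat_le t w : hat w t <= (k t + 1)^-1.
Proof. by rewrite /xihat ge_min lexx orbT. Qed.

Lemma hat_ge t w : (0 < t)%N -> -1 <= hat w t.
Proof.
move=> t0; have /andP[i0 _] := invk1_bounds t0.
rewrite /xihat le_min; apply/andP; split; last by lra.
(* At t = 1 the average runs over no terms and equals 0. *)
rewrite /avg; case: t.-1 => [|m]; first by rewrite big_geq// mulr0; lra.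
rewrite mulrC ler_pdivlMr// mulN1r.
have -> : - m.+1%:R = \sum_(1 <= i < m.+2) (- 1) :> R.
  by rewrite sumr_const_nat subn1 mulNrn.
apply: ler_sum_nat => i /andP[i1 _]; have := xi_bounds w i1; have := invk1_bounds i1; lra.
Qed.

Lemma sigma2hat_gt0 w t : 0 < sigma2hat sigma02 k (fun i => xi w i) t.
Proof.
rewrite /sigma2hat divr_gt0//.
by rewrite ltr_pwDl// sumr_ge0// => i _; exact: sqr_ge0.
Qed.

Lemma ln1n_gt0 t : (0 < t)%N -> 0 < ln (1 + t%:R) :> R.
Proof. by move=> t0; rewrite ln_gt0// ltrDl ltr0n. Qed.

Lemma ln2a_gt0 : 0 < ln (2 / alpha).
Proof. by case/andP: Halpha => a0 a1; rewrite ln_gt0// ltr_pdivlMr//; lra. Qed.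

Lemma lam_gt0 t w : (0 < t)%N -> 0 < lam w t.
Proof.
move=> t0; rewrite /lambda lt_min sqrtr_gt0 invr_gt0 ltr0n andbT.
apply: divr_gt0; first by rewrite mulr_gt0// ln2a_gt0.
by rewrite mulr_gt0 ?ln1n_gt0// mulr_gt0 ?ltr0n// sigma2hat_gt0.
Qed.

Lemma lam_bounds t w : (0 < t)%N -> 0 <= lam w t <= 1 / 2.
Proof.
move=> t0; rewrite (ltW (lam_gt0 w t0))/= /lambda ge_min; apply/orP; right; lra.
Qed.

Lemma xi_past n t : (0 < t < n)%N -> bounded_gfun (past n n) (fun w => xi w t).
Proof.
move=> /andP[t0 tn]; apply: bounded_mfunM; last exact: bounded_mfun_cst.
apply: bounded_gfun_sub (aipw_past t0); apply: sigma_sub => E.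
by move/(gen_past_sub tn tn); exact: sub_sigma_algebra.
Qed.

Lemma avg_past n m : (m < n)%N ->
  bounded_gfun (past n n) (fun w => avg (fun i => xi w i) m).
Proof.
move=> mn; apply: bounded_mfunM; first exact: bounded_mfun_cst.
apply: bounded_mfun_sum_nat => i /andP[i1 im]; apply: xi_past.
by rewrite i1 (leq_ltn_trans _ mn).
Qed.

Lemma hat_past t : (0 < t)%N -> bounded_gfun (past t t) (fun w => hat w t).
Proof.
move=> t0; apply: bounded_mfun_min; last exact: bounded_mfun_cst.
by apply: avg_past; rewrite prednK.
Qed.

(** [lambda] at t reads [sigma2hat] at t - 1, hence only xi_1, ..., xi_{t-1}: the bet is fixed
    before time t. *)
Lemma lam_past t : (0 < t)%N -> bounded_gfun (past t t) (fun w => lam w t).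
Proof.
move=> t0; split; last first.
  by exists 1 => w; have /andP[l0 l1] := lam_bounds w t0; rewrite ger0_norm//; lra.
have ms2 : gmeasurable (past t t) (fun w => sigma2hat sigma02 k (fun i => xi w i) t.-1).
  suff [] : bounded_gfun (past t t)
    (fun w => sigma2hat sigma02 k (fun i => xi w i) t.-1) by [].
  apply: bounded_mfunM; last exact: bounded_mfun_cst.
  apply: bounded_mfunD; first exact: bounded_mfun_cst.
  apply: bounded_mfun_sum_nat => i /andP[i1 im].
  have it : (i < t)%N by rewrite -(prednK t0).
  have bB : bounded_gfun (past t t)
      (fun w => xi w i - xibar k (fun i => xi w i) i).
    apply: bounded_mfunB; first by apply: xi_past; rewrite i1.
    by apply: bounded_mfun_min; [exact: avg_past|exact: bounded_mfun_cst].
  by under eq_fun do rewrite expr2; exact: bounded_mfunM.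
apply: measurable_minr; last exact: measurable_cst.
apply: measurable_fun_sqrt; apply: measurable_funM; first exact: measurable_cst.
apply: measurable_funV_gt0.
  by move=> w; rewrite mulr_gt0 ?ln1n_gt0// mulr_gt0 ?ltr0n// sigma2hat_gt0.
apply: measurable_funM; last exact: measurable_cst.
by apply: measurable_funM => //; exact: measurable_cst.
Qed.

Lemma psiE_lam_past t : (0 < t)%N -> bounded_gfun (past t t) (fun w => psiE (lam w t)).
Proof.
move=> t0; split; last first.
  exists 1 => w; have l02 := lam_bounds w t0.
  have l01 : 0 <= lam w t < 1 by lra.
  by rewrite ger0_norm ?psiE_ge0//; have := psiE_le_fifth l02; lra.
have ml := (lam_past t0).1.
apply: measurable_funB => //; apply: measurableT_comp => //.
apply: measurableT_comp => //; apply: measurable_funB => //; exact: measurable_cst.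
Qed.

(** * Supermartingale property and coverage *)

Lemma mean_step t (V F g s c : T -> R) : (0 < t)%N ->
  bounded_gfun (past t t) V -> bounded_gfun (past t t) g ->
  bounded_gfun (past t t) s -> bounded_gfun (past t t) c -> bounded_mfun F ->
  (forall w, 0 <= V w) ->
  (forall w, F w <= g w * (1 + s w * (xi w t - c w))) ->
  (forall w, g w * (1 + s w * ((k t + 1)^-1 * ate - c w)) <= 1) ->
  \int[P]_w (V w * F w) <= \int[P]_w V w.
Proof.
move=> t0 bV bg bs bc bF V0 Fle gle.
have low (h : T -> R) : bounded_gfun (past t t) h -> bounded_mfun h.
  by apply: bounded_gfun_mfun; exact: past_measurable.
have bh : bounded_mfun (aipw t).
  by apply: bounded_gfun_mfun (aipw_past t0); exact: past_measurable.
(* The weighted bound on F is affine in the score: U + W times [aipw t], with U and W known before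
   time t. [mean_aipw] then replaces [aipw t] by [ate]. *)
pose W w := V w * g w * s w * (k t + 1)^-1.
pose U w := V w * g w * (1 - s w * c w).
have bW : bounded_gfun (past t t) W.
  apply: bounded_mfunM; last exact: bounded_mfun_cst.
  by apply: bounded_mfunM => //; exact: bounded_mfunM.
have bU : bounded_gfun (past t t) U.
  apply: bounded_mfunM; first exact: bounded_mfunM.
  by apply: bounded_mfunB; [exact: bounded_mfun_cst|exact: bounded_mfunM].
have bWh : bounded_mfun (fun w => W w * aipw t w) by apply: bounded_mfunM => //; exact: low.
apply: (@le_trans _ _ (\int[P]_w (U w + W w * aipw t w))).
  apply: le_mean.
  - by apply: bounded_mfunM => //; exact: low.
  - by apply: bounded_mfunD => //; exact: low.
  - move=> w; apply: le_trans (ler_wpM2l (V0 w) (Fle w)) _.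
    by rewrite le_eqVlt; apply/orP; left; apply/eqP; rewrite /U /W; ring.
rewrite meanD//; last exact: low.
rewrite mean_aipw// -meanZ; last exact: low.
rewrite -meanD; [|exact: low|by apply: bounded_mfunM; [exact: bounded_mfun_cst|exact: low]].
apply: le_mean; [|exact: low|].
  apply: bounded_mfunD; first exact: low.
  by apply: bounded_mfunM; [exact: bounded_mfun_cst|exact: low].
move=> w; rewrite -[leRHS]mulr1; apply: le_trans (ler_wpM2l (V0 w) (gle w)).
by rewrite le_eqVlt; apply/orP; left; apply/eqP; rewrite /U /W; ring.
Qed.

(* s = 1 bets against the lower confidence bound and s = -1 against the upper. *)
Definition log_increment (s : R) (t : nat) (w : T) : R :=
  s * (lam w t * (xi w t - (k t + 1)^-1 * ate)) -
  (xi w t - hat w t) ^+ 2 * psiE (lam w t).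

Definition capital (s : R) (n : nat) (w : T) : R :=
  expR (\sum_(1 <= t < n.+1) log_increment s t w).

Lemma capitalS s n w :
  capital s n.+1 w = capital s n w * expR (log_increment s n.+1 w).
Proof. by rewrite /capital big_nat_recr//= expRD. Qed.

Lemma past_diag_sub t n : (t <= n)%N -> <<s past t t >> `<=` <<s past n n >>.
Proof.
by move=> tn; apply: sigma_sub => E /(gen_past_sub tn tn); exact: sub_sigma_algebra.
Qed.

Lemma log_increment_past s t : (0 < t)%N ->
  bounded_gfun (past t.+1 t.+1) (log_increment s t).
Proof.
move=> t0; have tt : (0 < t < t.+1)%N by rewrite t0 /=.
have up (h : T -> R) : bounded_gfun (past t t) h -> bounded_gfun (past t.+1 t.+1) h.
  by apply: bounded_gfun_sub; exact: past_diag_sub.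
have bx := xi_past tt.
have bD : bounded_gfun (past t.+1 t.+1) (fun w => xi w t - hat w t).
  by apply: bounded_mfunB => //; apply: up; exact: hat_past.
apply: bounded_mfunB.
  apply: bounded_mfunM; first exact: bounded_mfun_cst.
  apply: bounded_mfunM; first by apply: up; exact: lam_past.
  by apply: bounded_mfunB => //; exact: bounded_mfun_cst.
apply: bounded_mfunM; last by apply: up; exact: psiE_lam_past.
by under eq_fun do rewrite expr2; exact: bounded_mfunM.
Qed.

Lemma capital_past s n : bounded_gfun (past n.+1 n.+1) (capital s n).
Proof.
apply: bounded_mfun_expR; apply: bounded_mfun_sum_nat => t /andP[t1 tn].
by apply: bounded_gfun_sub (log_increment_past s t1); exact: past_diag_sub.
Qed.

Lemma capital_step s t (V : T -> R) : (0 < t)%N -> s = 1 \/ s = -1 ->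
  bounded_gfun (past t t) V -> (forall w, 0 <= V w) ->
  \int[P]_w (V w * expR (log_increment s t w)) <= \int[P]_w V w.
Proof.
move=> t0 s1 bV V0; pose b := (k t + 1)^-1.
have /andP[b0 b1] : 0 < b <= 1 := invk1_bounds t0.
have bF : bounded_mfun (fun w => expR (log_increment s t w)).
  apply: bounded_mfun_expR; apply: bounded_gfun_mfun (log_increment_past s t0).
  exact: past_measurable.
have cst (r : R) : bounded_gfun (past t t) (fun=> r) by exact: bounded_mfun_cst.
have bl := lam_past t0; have bh := hat_past t0; have bpsi := psiE_lam_past t0.
move: bF; case: s1 => -> bF; rewrite /log_increment in bF *.
- apply: (@mean_step t V _ (fun w => expR (lam w t * (hat w t - b * ate)))
    (fun w => lam w t) (fun w => hat w t)) => //.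
  + apply: bounded_mfun_expR; apply: bounded_mfunM => //.
    by apply: bounded_mfunB => //; exact: cst.
  + by move=> w; rewrite mul1r; apply: upper_step; [exact: lam_bounds|
      case/andP: (xi_bounds w t0)|exact: hat_le].
  + by move=> w; exact: upper_step_mean.
- have bsh : bounded_gfun (past t t) (fun w => lower_shift b (hat w t)).
    by apply: bounded_mfun_max => //; exact: cst.
  apply: (@mean_step t V _ (fun w => expR (- (lam w t * (lower_shift b (hat w t) - b * ate))))
    (fun w => - lower_slope (lam w t) b (hat w t)) (fun w => lower_shift b (hat w t))) => //.
  + apply: bounded_mfun_expR; apply: bounded_mfunN; apply: bounded_mfunM => //.
    by apply: bounded_mfunB => //; exact: cst.
  + apply: bounded_mfunN; apply: bounded_mfunD => //; apply: bounded_mfunM => //.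
    apply: bounded_mfunM; last by apply: bounded_mfunB => //; exact: cst.
    by apply: bounded_mfunM; [exact: cst|exact: bounded_mfunB].
  + move=> w; rewrite mulN1r mulNr; apply: lower_step; [exact: lam_bounds|exact: ltW|
      exact: xi_bounds|exact: hat_ge].
  + move=> w; rewrite mulNr; apply: lower_step_mean; first exact: lam_bounds.
    by have /andP[a1 a2] := ate_bound; rewrite -mulrN1 ler_wpM2l// ltW.
Qed.

(** Multiplying by the positive denominator D turns the two-sided bound into two linear
    inequalities, one for the logarithm of each capital. *)
Lemma capital_event w n : (0 < n)%N ->
  (`|ate - CS_center alpha sigma02 k (fun i => xi w i) n| <=
     CS_radius alpha sigma02 k (fun i => xi w i) n) <->
  (capital 1 n w <= 2 / alpha /\ capital (-1) n w <= 2 / alpha).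
Proof.
move=> n0; have /andP[a0 a1] := Halpha.
have q0 : 0 < 2 / alpha by rewrite divr_gt0.
pose D := \sum_(1 <= t < n.+1) lam w t / (k t + 1).
pose S := \sum_(1 <= t < n.+1) lam w t * xi w t.
pose V := \sum_(1 <= t < n.+1) (xi w t - hat w t) ^+ 2 * psiE (lam w t).
have D0 : 0 < D.
  rewrite /D big_ltn// ltr_pwDl//; first by rewrite divr_gt0 ?k1_gt0 ?lam_gt0.
  rewrite big_nat_cond sumr_ge0// => t /andP[/andP[t2 _] _].
  have t0 : (0 < t)%N by exact: ltn_trans t2.
  by rewrite divr_ge0 ?ltW ?k1_gt0 ?lam_gt0.
have capE s : (capital s n w <= 2 / alpha) = (s * (S - D * ate) - V <= ln (2 / alpha)).
  rewrite /capital -[RHS]ler_expR lnK ?posrE//; congr (expR _ <= _).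
  rewrite /log_increment sumrB -mulr_sumr; congr (s * _ - _).
  rewrite /S /D mulr_suml -sumrB; apply: eq_bigr => t _; ring.
rewrite !capE /CS_center /CS_radius /CS_denom -/D -/S -/V.
have -> : ate - S / D = (ate * D - S) / D by field; rewrite gt_eqF.
rewrite normrM normfV (gtr0_norm D0) ler_pM2r ?invr_gt0// ler_norml.
split=> [/andP[h1 h2]|[h1 h2]]; [split|apply/andP; split]; lra.
Qed.

Lemma capital_confidence :
  ((1 - alpha)%:E <= P [set w | forall n : nat, (0 < n)%N ->
    (`|ate - CS_center alpha sigma02 k (fun i => xi w i) n| <=
     CS_radius alpha sigma02 k (fun i => xi w i) n)%R])%E.
Proof.
have /andP[a0 a1] := Halpha.
(* If the average is at most 1 / alpha, each capital is at most 2 / alpha because the other is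
   nonnegative; no union bound is needed. *)
pose M n w := (capital 1 n w + capital (-1) n w) / 2.
have M_past n : bounded_gfun (past n.+1 n.+1) (M n).
  apply: bounded_mfunM; last exact: bounded_mfun_cst.
  by apply: bounded_mfunD; exact: capital_past.
have low n (h : T -> R) : bounded_gfun (past n n) h -> bounded_mfun h.
  by apply: bounded_gfun_mfun; exact: past_measurable.
have cap0 s w : capital s 0 w = 1 by rewrite /capital big_geq// expR0.
have [mD PD] : measurable [set w | forall n, M n w <= alpha^-1] /\
    ((1 - alpha^-1^-1)%:E <= P [set w | forall n, (M n w <= alpha^-1)%R])%E.
  (* Both bounds in [gen_past] are strict, so the data up to time n correspond to index n + 1. *)
  apply: (ville_inequality (G := fun n => past n.+1 n.+1)).
  - by move=> n; exact: past_measurable.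
  - by move=> n; exact: past_diag_sub.
  - by move=> n; case: (M_past n).
  - by move=> n; case: (M_past n).
  - by move=> n w; rewrite divr_ge0// addr_ge0 ?expR_ge0.
  - by move=> w; rewrite /M !cap0; lra.
  - move=> n E GE.
    have bV s : bounded_gfun (past n.+1 n.+1) (fun w => \1_E w * capital s n w).
      by apply: bounded_mfunM; [exact: bounded_gfun_indic|exact: capital_past].
    have bE : bounded_mfun (\1_E : T -> R) := low _ _ (bounded_gfun_indic GE).
    have bS s m : bounded_mfun (fun w => \1_E w * capital s m w).
      by apply: bounded_mfunM => //; apply: low; exact: capital_past.
    have split2 m : \int[P]_w (\1_E w * M m w) =
        2^-1 * (\int[P]_w (\1_E w * capital 1 m w) + \int[P]_w (\1_E w * capital (-1) m w)).
      rewrite -meanD// -meanZ; last exact: bounded_mfunD.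
      by apply: eq_Rintegral => w _; rewrite /M; ring.
    have one s : s = 1 \/ s = -1 ->
        \int[P]_w (\1_E w * capital s n.+1 w) <= \int[P]_w (\1_E w * capital s n w).
      move=> s1; under eq_Rintegral do rewrite capitalS mulrA.
      apply: capital_step => // w.
      by rewrite mulr_ge0 ?expR_ge0// indicE.
    by rewrite !split2 ler_pM2l ?invr_gt0//; apply: lerD; apply: one; [left|right].
  - by rewrite invr_gt0.
rewrite invrK in PD; apply: le_trans PD _.
apply: le_measure; rewrite ?inE//.
  (* Monotonicity of P needs the coverage event to be measurable; it is a countable intersection of
     capital events. Index 0 adds nothing, both capitals being 1 there. *)
  have -> : [set w | forall n : nat, (0 < n)%N ->
      `|ate - CS_center alpha sigma02 k (fun i => xi w i) n| <=
      CS_radius alpha sigma02 k (fun i => xi w i) n] =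
    \bigcap_n ([set w | capital 1 n w <= 2 / alpha] `&`
               [set w | capital (-1) n w <= 2 / alpha]).
    apply/seteqP; split => w h.
      case=> [_|n _]; last by apply/capital_event => //; exact: h.
      have : 1 <= 2 / alpha by rewrite ler_pdivlMr//; lra.
      by split; rewrite /= cap0.
    by move=> n n0; apply/capital_event => //; exact: h.
  apply: bigcapT_measurable => n.
  have meas s : measurable [set w | capital s n w <= 2 / alpha].
    apply: (sigma_measurable (@past_measurable n.+1 n.+1)); apply: gmeasurable_le.
    by case: (capital_past s n).
  exact: measurableI.
move=> w /= h n n0; apply/capital_event => //.
have := h n; rewrite /M ler_pdivrMr// [_^-1 * 2]mulrC.
have : 0 <= capital 1 n w by exact: expR_ge0.
have : 0 <= capital (-1) n w by exact: expR_ge0.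
by split; lra.
Qed.

End AdaptiveExperiment.

Unset Implicit Arguments. Set Strict Implicit. Set Printing Implicit Defensive.

Theorem theorem3
  (R : realType) (dT : measure_display) (T : measurableType dT)
  (dX : measure_display) (Xs : measurableType dX)
  (P : probability T R)
  (X : nat -> T -> Xs) (Y0 Y1 : nat -> T -> R) (A : nat -> T -> bool)
  (pi : nat -> Xs -> seq (Xs * bool * R) -> R)
  (fhat : nat -> bool -> Xs -> seq (Xs * bool * R) -> R)
  (k : nat -> R) (alpha sigma02 : R)
  (* i.i.d. tuples (X_t, Y_t(0), Y_t(1)), t >= 1 *)
  (Hiid : iid_tuples P (Ztuple X Y0 Y1))
  (* outcomes in [0, 1] *)
  (HY : forall t w, (0 < t)%N -> 0 <= Y0 t w <= 1 /\ 0 <= Y1 t w <= 1)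
  (* treatments are random variables *)
  (HA : forall t, (0 < t)%N -> measurable [set w | A t w])
  (* truncation parameters k_t >= 2 and truncated propensities *)
  (Hk : forall t, (0 < t)%N -> 2 <= k t)
  (Hpi : forall t w, (0 < t)%N ->
     (k t)^-1 <= pi t (X t w) (hist X A Y0 Y1 t.-1 w) <= 1 - (k t)^-1)
  (* pi_t(1 | X_t, Omega_{t-1}) is sigma(X_t, Omega_{t-1})-measurable *)
  (Hpimeas : forall t, (0 < t)%N ->
     measurable_wrt <<s gen_XtHist X A Y0 Y1 t >>
       (fun w => pi t (X t w) (hist X A Y0 Y1 t.-1 w)))
  (* \hat f_{t-1}(a, X_t) is a [0,1]-valued sigma(X_t, Omega_{t-1})-measurable estimate *)
  (Hfhat : forall t a w, (0 < t)%N ->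
     0 <= fhat t.-1 a (X t w) (hist X A Y0 Y1 t.-1 w) <= 1)
  (Hfmeas : forall t a, (0 < t)%N ->
     measurable_wrt <<s gen_XtHist X A Y0 Y1 t >>
       (fun w => fhat t.-1 a (X t w) (hist X A Y0 Y1 t.-1 w)))
  (* P(A_t = 1 | Omega_{t-1}, all tuples (X_s, Y_s(0), Y_s(1))) = pi_t(1 | X_t, Omega_{t-1}) *)
  (Hrand : forall t, (0 < t)%N -> forall E : set T,
     <<s gen_HistTuples X A Y0 Y1 t >> E ->
     P (E `&` [set w | A t w]) =
       (\int[P]_(w in E) (pi t (X t w) (hist X A Y0 Y1 t.-1 w))%:E)%E)
  (Halpha : 0 < alpha < 1) (Hsigma02 : 0 < sigma02) :
  let theta0 : R := fine (\int[P]_w ((Y1 1%N w - Y0 1%N w)%:E))%E in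
  let xi (w : T) (t : nat) : R := hAIPW X A Y0 Y1 pi fhat t w / (k t + 1) in
  ((1 - alpha)%:E <=
   P [set w | forall TT : nat, (0 < TT)%N ->
        (`|theta0 - CS_center alpha sigma02 k (xi w) TT|
          <= CS_radius alpha sigma02 k (xi w) TT)%R])%E.
Proof.
pose p t w := pi t (X t w) (hist X A Y0 Y1 t.-1 w).
pose f t a w := fhat t.-1 a (X t w) (hist X A Y0 Y1 t.-1 w).
have Hp01 t w : (0 < t)%N -> 0 <= p t w <= 1.
  move=> t0; have k2 := Hk t t0; have /andP[p0 p1] := Hpi t w t0.
  have ki : 0 < (k t)^-1 by rewrite invr_gt0; lra.
  by rewrite /p; lra.
have Hpm t : (0 < t)%N -> gmeasurable (gen_XtHist X A Y0 Y1 t) (p t).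
  by move=> t0; apply/gmeasurableP; exact: Hpimeas.
have Hfm t a : (0 < t)%N -> gmeasurable (gen_XtHist X A Y0 Y1 t) (f t a).
  by move=> t0; apply/gmeasurableP; exact: Hfmeas.
(* For these processes [hAIPW] and [theta0] are convertible to [aipw] and [ate]. *)
exact: (capital_confidence Hiid HA Hp01 Hpm Hrand HY Hk Hpi Hfhat Hfm Halpha Hsigma02).
Qed.
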